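(* Let $G=(V,E)$ be a finite connected planar graph with positive coupling constants $J:E\to(0,\infty)$. Let $A=\{a_1,\dots,a_k\}$ and $B=\{b_1,\dots,b_k\}$ be disjoint sets of vertices on the outer face of $G$ such that $a_1,\dots,a_k,b_k,\dots,b_1$ is a counterclockwise order on $A\cup B$, and let $v_1,v_2,\dots,v_{2k}$ be a counterclockwise order on $A\cup B$. Let $M^{A,B}$ be the $k\times k$ matrix $M^{A,B}_{i,j}=\langle\sigma_{a_i}\sigma_{b_j}\rangle$, and let $K^{A\cup B}$ be the $2k\times 2k$ skew-symmetric matrix satisfying $$K^{A\cup B}_{i,j}=\langle\sigma_{v_i}\sigma_{v_j}\rangle\qquad\text{for } i<j.$$ Then $$\mathbf P^{A\cup B}_{\mathrm{d\text{-}curr}}(\mathcal P_{A,B})=\frac{\det M^{A,B}}{\operatorname{Pf}K^{A\cup B}},$$ where $\operatorname{Pf}$ denotes the Pfaffian of a skew-symmetric matrix.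
   Context: Ising model: the Ising model on $G$ with free boundary conditions and no external field is the probability measure on $\{-1,1\}^V$ given by $\mathbf P(\sigma)=\frac1Z\prod_{\{u,v\}\in E}\exp(J_{\{u,v\}}\sigma_u\sigma_v)$, where $Z$ is the normalizing constant. For $u,v\in V$, $\langle\sigma_u\sigma_v\rangle$ denotes the expectation of $\sigma_u\sigma_v$. Random currents: a current on $G$ is a function $\mathbf n:E\to\{0,1,2,\dots\}$. Its set of sources $\partial\mathbf n$ is the set of vertices $v$ such that $\sum_{u:\{u,v\}\in E}\mathbf n_{\{u,v\}}$ is odd. For $S\subseteq V$, $\Omega_S=\{\mathbf n:\partial\mathbf n=S\}$. The weight of a current is $\mathrm w(\mathbf n)=\prod_{e\in E}\frac{(J_e)^{\mathbf n_e}}{\mathbf n_e!}$. The random current measure with boundary conditions $S$ is $\mathbf P^S_{\mathrm{curr}}(\mathbf n)=\mathrm w(\mathbf n)/Z^S_{\mathrm{curr}}$ for $\mathbf n\in\Omega_S$, with $Z^S_{\mathrm{curr}}=\sum_{\mathbf n\in\Omega_S}\mathrm w(\mathbf n)$. The double random current measure $\mathbf P^S_{\mathrm{d\text{-}curr}}$ on $\Omega_S$ is the law of $\mathbf n_1+\mathbf n_2$, where $\mathbf n_1$ and $\mathbf n_2$ are independent with laws $\mathbf P^S_{\mathrm{curr}}$ and $\mathbf P^\emptyset_{\mathrm{curr}}$ respectively. Parallel connections: for $u,v\in V$ and a current $\mathbf n$, say that $u$ and $v$ are connected in $\mathbf n$ if they are connected in $G$ by a path of edges with non-zero values of $\mathbf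 n$. The event $\mathcal P_{A,B}$ is the set of $\mathbf n\in\Omega_{A\cup B}$ such that $a_i$ and $b_i$ are connected in $\mathbf n$ for all $i$, and $a_i$ and $b_j$ are not connected in $\mathbf n$ for all $i\neq j$. *)

(* Defs.v *)
From mathcomp Require Import all_boot all_order all_algebra all_fingroup.
From mathcomp Require Import classical_sets reals ereal esum sequences exp.

Set Implicit Arguments.
Unset Strict Implicit.
Unset Printing Implicit Defensive.

Import GRing.Theory Num.Theory.
Local Open Scope ring_scope.

(* A finite simple graph is a finType V with a set E of two-element subsets
   of V. *)
Section Graph.
Variables (V : finType) (E : {set {set V}}).

Definition simple_graph := forall e : {set V}, e \in E -> #|e| = 2%N.

Definition adj : rel V := fun x y => [set x; y] \in E.

Definition connected_graph := forall x y : V, connect adj x y.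

Definition edge : predArgType := {e : {set V} | e \in E}.

End Graph.

(* Plane graphs are presented as combinatorial maps (rotation systems) of
   genus 0.  A dart is an oriented edge; rho sends a dart to the next one in
   counterclockwise order around its origin. *)
Section PlaneMap.
Variables (V : finType) (E : {set {set V}}).

Definition dart : predArgType := {p : V * V | [set p.1; p.2] \in E}.

Definition origin (d : dart) : V := (val d).1.

Lemma drev_subproof (d : dart) : [set (val d).2; (val d).1] \in E.
Proof. by rewrite finset.setUC; exact: (valP d). Qed.

Definition drev (d : dart) : dart :=
  exist (fun p : V * V => [set p.1; p.2] \in E)
        ((val d).2, (val d).1) (drev_subproof d).

(* Turning counterclockwise from the reversed dart keeps the face on the
   right-hand side.  Hence the orbit of a dart with the outer face on its right
   is the walk around the graph along the outer face in counterclockwise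
   order. *)
Definition face_next (rho : {perm dart}) (d : dart) : dart := rho (drev d).

(* rho cyclically permutes the darts at each vertex, and Euler's formula
   #V - #E + #F = 2 holds (for a connected graph with at least one edge, the
   faces are the orbits of face_next). *)
Definition plane_embedding (rho : {perm dart}) : Prop :=
  (forall d d' : dart, fconnect rho d d' = (origin d == origin d')) /\
  (#|V| + fcard (face_next rho) [pred _ : dart | true] = #|E| + 2)%N.

(* s enumerates S without repetition, in an order in which these vertices are
   met along one counterclockwise turn around the face of the dart o (taken as
   the outer face), from some starting dart.  The walk may meet a cut vertex
   several times; any of these visits may be used. *)
Definition ccw_order (rho : {perm dart}) (o : dart) (S : {set V}) (s : seq V) :
    Prop :=
  [/\ uniq s, s =i S &
      exists2 d : dart, fconnect (face_next rho) o d &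
        subseq s [seq origin x | x <- fingraph.orbit (face_next rho) d]].

End PlaneMap.

Section Ising.
Variables (R : realType) (V : finType) (E : {set {set V}}) (J : edge E -> R).

(* The spin configuration s assigns -1 to the vertices where it is true and 1
   to the others. *)
Definition spin (s : {ffun V -> bool}) (x : V) : R := (-1) ^+ s x.

Definition ising_weight (s : {ffun V -> bool}) : R :=
  \prod_(e : edge E) expR (J e * \prod_(x in val e) spin s x).

Definition ising_Z : R := \sum_(s : {ffun V -> bool}) ising_weight s.

Definition ising_prob (s : {ffun V -> bool}) : R := ising_weight s / ising_Z.

Definition ising_corr (x y : V) : R :=
  \sum_(s : {ffun V -> bool}) ising_prob s * (spin s x * spin s y).

End Ising.

Section Currents.
Variables (R : realType) (V : finType) (E : {set {set V}}) (J : edge E -> R).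

Definition current : Type := {ffun edge E -> nat}.

Definition sources (n : current) : {set V} :=
  [set x | odd (\sum_(e : edge E | x \in val e) n e)].

Definition Omega (S : {set V}) : set current :=
  [set n : current | sources n = S]%classic.

Definition curr_weight (n : current) : R :=
  \prod_(e : edge E) (J e ^+ n e / (n e)`!%:R).

Definition curr_Z (S : {set V}) : \bar R :=
  \esum_(n in Omega S) (curr_weight n)%:E.

Definition curr_prob (S : {set V}) (n : current) : R :=
  if sources n == S then curr_weight n / fine (curr_Z S) else 0.

Definition curr_add (n1 n2 : current) : current :=
  [ffun e : edge E => (n1 e + n2 e)%N].

(* Probability of the event X under the law of n1 + n2, for independent n1 and
   n2 with laws curr_prob S and curr_prob set0. *)
Definition dcurr_prob (S : {set V}) (X : set current) : \bar R :=
  \esum_(p in [set p : current * current | X (curr_add p.1 p.2)]%classic)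
    (curr_prob S p.1 * curr_prob finset.set0 p.2)%:E.

Definition curr_connected (n : current) (x y : V) : bool :=
  connect (fun u v : V =>
    [exists e : edge E, (val e == [set u; v]) && (n e != 0%N)]) x y.

Definition parallel_connections (k : nat) (a b : k.-tuple V) : set current :=
  [set n : current |
    [/\ Omega ([set x in a] :|: [set x in b])%SET n,
        forall i : 'I_k, curr_connected n (tnth a i) (tnth b i) &
        forall i j : 'I_k, i != j ->
          ~~ curr_connected n (tnth a i) (tnth b j)]]%classic.

End Currents.

Section Pfaffian.
Variables (R : fieldType) (k : nat).

Lemma ord_even_subproof (i : 'I_k) : (i.*2 < k.*2)%N.
Proof. by rewrite ltn_double. Qed.

Lemma ord_odd_subproof (i : 'I_k) : (i.*2.+1 < k.*2)%N.
Proof. by rewrite ltn_Sdouble. Qed.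

Definition ord_even (i : 'I_k) : 'I_k.*2 := Ordinal (ord_even_subproof i).

Definition ord_odd (i : 'I_k) : 'I_k.*2 := Ordinal (ord_odd_subproof i).

(* The division is meaningful in characteristic 0. *)
Definition pfaffian (A : 'M[R]_k.*2) : R :=
  (\sum_(s : 'S_k.*2)
     (-1) ^+ s * \prod_(i < k) A (s (ord_even i)) (s (ord_odd i)))
  / (2 ^ k * k`!)%:R.

End Pfaffian.

Section Matrices.
Variables (R : realType) (V : finType) (E : {set {set V}}) (J : edge E -> R).

Definition corr_matrix (k : nat) (a b : k.-tuple V) : 'M[R]_k :=
  \matrix_(i, j) ising_corr J (tnth a i) (tnth b j).

Definition skew_corr_matrix (m : nat) (v : m.-tuple V) : 'M[R]_m :=
  \matrix_(i, j)
    if (i < j)%N then ising_corr J (tnth v i) (tnth v j)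
    else if (j < i)%N then - ising_corr J (tnth v j) (tnth v i)
    else 0.

End Matrices.

(* Main.v *)
Require Import Defs.
From mathcomp Require Import all_boot all_order all_algebra all_fingroup.
From mathcomp Require Import classical_sets reals ereal esum sequences exp.
From mathcomp Require Import boolp fsbigop normedtype.
From mathcomp Require Import ring lra zify.

Set Implicit Arguments.
Unset Strict Implicit.
Unset Printing Implicit Defensive.

Import Order.TTheory GRing.Theory Num.Theory.
Import numFieldNormedType.Exports.
Local Open Scope ring_scope.

(** The double random current measure is governed by the switching lemma.  A
pair of currents is recorded, edge by edge, by the parities of the two currents
and by the set O of edges where their sum is nonzero; the sum over all pairs is
thus a finite sum, with an explicit weight for each O.  If t and u split the
sources into two lists, moving the sources t from the first current to the
second one costs nothing when every cluster of O contains an even number of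
elements of t, and is impossible otherwise.  Hence, up to the square of the
partition function without sources,

  <sigma_t> <sigma_u> = sum over O of  mu(O) * [t is even in every cluster of O],

where mu(O) does not depend on the splitting (Z_mul).

Planarity enters through a single fact (noncrossing_ccw): the clusters of O cut
the cyclically ordered boundary vertices into a noncrossing partition.  For a
noncrossing partition with even classes the signs along a class alternate, so
that [t is even in every cluster] is itself the Pfaffian of the 0-1 kernel
[x and y are in the same cluster] (pf_link).  Expanding along the first source,
the same alternation yields <sigma_S> = Pf K (Z_pf), which is the denominator.

For the numerator, put a sign w = 1 on A and w = -1 on B.  The kernel
(1 - w_x w_y) <sigma_x sigma_y> vanishes inside A and inside B and is
2 <sigma_x sigma_y> across, so its Pfaffian in the order a_1..a_k, b_k..b_1 is
2^k det M.  On the other hand the Pfaffian of a sum of two kernels is a signed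
sum, over all splittings (t, u) of the sources, of products of the two Pfaffians
(pfD); here these are products <sigma_t> <sigma_u> with coefficients that depend
only on the splitting.  Each product is the mu-average of the corresponding
product for the 0-1 kernel of O, and reading the identity backwards turns
2^k det M into the mu-average of 2^k det [a_i and b_j are in the same cluster].
For a noncrossing partition with even classes this determinant is 1 if the
clusters pair each a_i with b_i only, and 0 otherwise because two rows or two
columns agree (det_parallel_classes).  So det M is exactly the mu-mass of the
parallel connections (det_corr).

The noncrossing property is a discrete Jordan curve theorem.  Euler's formula
says, by counting dimensions over the field with two elements, that every even
set of edges is the boundary of a set of faces (cycle_coboundary).  A path joining
two corners of the outer face, closed up by an arc of that face, is therefore
such a boundary; exchanging the two colours along the arc gives a two-colouring of
the corners that changes only across the path and at its two ends, and this
prevents another cluster from having corners on both sides (noncrossing_face). *)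

(** * Pfaffians as functions of lists *)

Section Contraction.
Variables (R : comNzRingType) (T : Type).
Implicit Types (A B : T -> T -> R) (h : seq T -> R) (s t u : seq T).

(** The row expansion of a Pfaffian.  On functions of lists it acts as an odd
derivation, the contraction of the exterior algebra by the linear form A x. *)
Fixpoint contraction A (x : T) h t : R :=
  if t is y :: t' then A x y * h t' - contraction A x (fun u => h (y :: u)) t'
  else 0.

Lemma eq_contraction A A' x h h' t :
    (forall y, A x y = A' x y) ->
    (forall u, (size u).+1 = size t -> h u = h' u) ->
  contraction A x h t = contraction A' x h' t.
Proof.
move=> eA; elim: t h h' => //= y t IH h h' eh.
by rewrite eA eh // (IH _ (fun u => h' (y :: u))) // => u [su]; rewrite eh //= su.
Qed.

Lemma contractionD A x h1 h2 t :
  contraction A x (fun u => h1 u + h2 u) t = contraction A x h1 t + contraction A x h2 t.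
Proof. by elim: t h1 h2 => [|y t IH] h1 h2 /=; rewrite ?addr0 // IH; ring. Qed.

Lemma contractionZ A x c h t :
  contraction A x (fun u => c * h u) t = c * contraction A x h t.
Proof. by elim: t h => [|y t IH] h /=; rewrite ?mulr0 // IH; ring. Qed.

Fixpoint pf_rec n A s : R :=
  match s, n with
  | [::], _ => 1
  | _ :: _, 0 => 0
  | x :: s', n'.+1 => contraction A x (pf_rec n' A) s'
  end.

Definition pf A s := pf_rec (size s) A s.

Lemma pf_recE A n s : (size s <= n)%N -> pf_rec n A s = pf A s.
Proof.
rewrite /pf; elim/ltn_ind: n s => n IH [|x s]; case: n IH => [|n] IH //= sn.
by apply: eq_contraction => // u su; rewrite !IH //; lia.
Qed.

Lemma pf_nil A : pf A [::] = 1. Proof. by []. Qed.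

Lemma pf_cons A x s : pf A (x :: s) = contraction A x (pf A) s.
Proof.
rewrite {1}/pf /=; apply: eq_contraction => // u su.
by apply: pf_recE; rewrite -su.
Qed.

Lemma pf_odd A s : odd (size s) -> pf A s = 0.
Proof.
have [n] := ubnP (size s); elim: n s => // n IH [|x s] //= sn os.
rewrite pf_cons (@eq_contraction _ A _ _ (fun u => 0 * pf A u)) ?contractionZ ?mul0r //
  => u su.
rewrite mul0r IH //; first by lia.
by move: os; rewrite -su /= negbK.
Qed.

(** The coproduct of the exterior algebra: s is split in all ways into
complementary sublists t and u.  Putting x into u costs a sign for each later
entry that goes to t, since x has to move past it. *)
Fixpoint shuffle (F : seq T -> seq T -> R) s : R :=
  if s is x :: s' then
    shuffle (fun t u => F (x :: t) u) s'
    + shuffle (fun t u => (-1) ^+ size t * F t (x :: u)) s'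
  else F [::] [::].

Lemma eq_shuffle_ext F G s : (forall t u, F t u = G t u) -> shuffle F s = shuffle G s.
Proof.
elim: s F G => [|x s IH] F G FG //=; congr (_ + _); apply: IH => t u //.
by rewrite FG.
Qed.

Lemma shuffleD F G s :
  shuffle (fun t u => F t u + G t u) s = shuffle F s + shuffle G s.
Proof.
elim: s F G => [|x s IH] F G //=; rewrite !IH.
rewrite (@eq_shuffle_ext (fun t u => _ * (F _ _ + _)) (fun t u => (-1) ^+ size t * F t (x
  :: u)
 + (-1) ^+ size t * G t (x :: u))) ?IH; last by move=> t u; ring.
by ring.
Qed.

Lemma shuffleZ c F s : shuffle (fun t u => c * F t u) s = c * shuffle F s.
Proof.
elim: s F => [|x s IH] F //=; rewrite !IH mulrDr -IH; congr (_ + _).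
by rewrite -IH; apply: eq_shuffle_ext => t u; ring.
Qed.

Lemma shuffle_sum (I : Type) (r : seq I) (P : pred I) (F : I -> seq T -> seq T -> R) s :
  shuffle (fun t u => \sum_(i <- r | P i) F i t u) s = \sum_(i <- r | P i) shuffle (F i)
    s.
Proof.
elim: r => [|i r IH].
  rewrite big_nil -[RHS](mul0r (shuffle (fun _ _ => 0) s)) -shuffleZ.
  by apply: eq_shuffle_ext => t u; rewrite big_nil mul0r.
rewrite big_cons -IH; case: (boolP (P i)) => Pi.
  rewrite -shuffleD; apply: eq_shuffle_ext => t u.
  by rewrite big_cons Pi.
by apply: eq_shuffle_ext => t u; rewrite big_cons (negbTE Pi).
Qed.

(** Leibniz rule: a contraction is an odd derivation, so it acts on one of the
two factors at a time and picks up the sign of the factor it jumps over.  Using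
different kernels on the two factors is what makes the kernels add up. *)
Lemma contraction_shuffle A B x F s :
  contraction (fun y z => A y z + B y z) x (shuffle F) s =
    shuffle (fun t u => contraction A x (F^~ u) t) s +
    shuffle (fun t u => (-1) ^+ size t * contraction B x (F t) u) s.
Proof.
elim: s F => [|y s IH] F /=; first by rewrite !mulr0 addr0.
rewrite contractionD !IH !shuffleD.
set a := shuffle F s.
have -> : shuffle (fun t u => - contraction A x (fun v => F (y :: v) u) t) s =
          - shuffle (fun t u => contraction A x (fun v => F (y :: v) u) t) s.
  by rewrite -[RHS]mulN1r -shuffleZ; apply: eq_shuffle_ext => t u; rewrite mulN1r.
have -> : shuffle (fun t u => (-1) ^+ size t * contraction A x (F^~ (y :: u)) t) s =
          - shuffle (fun t u => contraction A x (fun v => (-1) ^+ size v * F v (y :: u))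
            t) s.
  rewrite -[RHS]mulN1r -shuffleZ; apply: eq_shuffle_ext => t u.
  rewrite (@eq_contraction A A x (fun v => _ * _) (fun v => (-1) ^+ (size t).-1 * F v (y
    :: u))) //.
    case: t => [|z t]; first by rewrite /= !mulr0.
    by rewrite contractionZ exprS; move: (contraction _ _ _ _) => c /=; ring.
  by move=> v <-.
have -> : shuffle (fun t u => (-1) ^+ (size t).+1 * contraction B x (F (y :: t)) u) s =
          - shuffle (fun t u => (-1) ^+ size t * contraction B x (F (y :: t)) u) s.
  by rewrite -[RHS]mulN1r -shuffleZ; apply: eq_shuffle_ext => t u; rewrite exprS mulrA.
have -> : shuffle (fun t u => (-1) ^+ size t * ((-1) ^+ size t *
            (B x y * F t u - contraction B x (fun v => F t (y :: v)) u))) s =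
          B x y * a - shuffle (fun t u => (-1) ^+ size t *
            contraction B x (fun v => (-1) ^+ size t * F t (y :: v)) u) s.
  rewrite /a -shuffleZ -[X in _ = _ + X]mulN1r -[X in _ = _ + X]shuffleZ -shuffleD;
    apply: eq_shuffle_ext => t u.
  by rewrite contractionZ !mulrA -(mulrA (-1)) -expr2 sqrr_sign mul1r mulr1 mulN1r.
by rewrite shuffleZ -/a; ring.
Qed.

End Contraction.

Section PfaffianLists.
Variables (R : comNzRingType).

(** Both sides satisfy the same expansion along the first entry, by the Leibniz
rule for contractions. *)
Lemma pfD (T : Type) (A B : T -> T -> R) s :
  pf (fun y z => A y z + B y z) s = shuffle (fun t u => pf A t * pf B u) s.
Proof.
have [n] := ubnP (size s); elim: n s => // n IH [|x s] /= sn.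
  by rewrite !pf_nil mulr1.
rewrite pf_cons (@eq_contraction _ _ _ (fun y z => A y z + B y z) x _
  (shuffle (fun t u => pf A t * pf B u))) //; last by move=> u su; apply: IH; lia.
rewrite contraction_shuffle; congr (_ + _); apply: eq_shuffle_ext => t u.
  rewrite pf_cons mulrC -contractionZ.
  by apply: eq_contraction => // v _; rewrite mulrC.
by rewrite pf_cons contractionZ.
Qed.

Lemma eq_shuffle (T : eqType) (F G : seq T -> seq T -> R) s :
    (forall t u, subseq t s -> subseq u s -> perm_eq (t ++ u) s -> F t u = G t u) ->
  shuffle F s = shuffle G s.
Proof.
elim: s F G => [|x s IH] F G FG /=; first exact: FG.
congr (_ + _); apply: IH => t u ts us tus.
  apply: FG => /=; rewrite ?eqxx ?perm_cons //.
  exact: subseq_trans us (subseq_cons _ _).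
rewrite FG ?eqxx //=; rewrite ?eqxx //.
  exact: subseq_trans ts (subseq_cons _ _).
by rewrite -cat1s perm_catCA /= perm_cons.
Qed.

Lemma contraction_scale (T : Type) (A : T -> T -> R) (c : R) (w : T -> R) x h t :
  contraction (fun y z => c * (w y * w z) * A y z) x
    (fun u => (\prod_(y <- u) w y) * h u) t =
  c * w x * (\prod_(y <- t) w y) * contraction A x h t.
Proof.
elim: t h => [|y t IH] h /=; first by rewrite mulr0.
rewrite (@eq_contraction _ _ _ (fun y z => c * (w y * w z) * A y z) x _
  (fun u => w y * ((\prod_(y <- u) w y) * h (y :: u)))) //; last first.
  by move=> u _; rewrite big_cons mulrA.
by rewrite contractionZ (IH (fun u => h (y :: u))) big_cons; ring.
Qed.

Lemma pf_scale (T : Type) (A : T -> T -> R) (c : R) (w : T -> R) s :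
  pf (fun y z => c * (w y * w z) * A y z) s =
  c ^+ (size s)./2 * (\prod_(y <- s) w y) * pf A s.
Proof.
have [n] := ubnP (size s); elim: n s => // n IH [|x s] /= sn.
  by rewrite big_nil !pf_nil !mulr1.
have [os|es] := boolP (odd (size s)); last by rewrite !pf_odd ?mulr0.
rewrite !pf_cons (@eq_contraction _ _ _ (fun y z => c * (w y * w z) * A y z) x _
  (fun u => \prod_(y <- u) w y * (c ^+ (size s).-1./2 * pf A u))) //; last first.
  by move=> u su; rewrite IH; [rewrite -su /=; ring | lia].
rewrite contraction_scale contractionZ big_cons.
have -> : uphalf (size s) = (size s).-1./2.+1 by lia.
by rewrite exprS; ring.
Qed.

Definition del (T : Type) (j : nat) (t : seq T) := take j t ++ drop j.+1 t.

Lemma size_del (T : Type) j (t : seq T) : (j < size t)%N -> (size (del j t)).+1 = size t.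
Proof. by move=> jt; rewrite size_cat size_takel ?size_drop; lia. Qed.

Lemma nth_del (T : Type) (x0 : T) j t l :
  (j < size t)%N -> nth x0 (del j t) l = nth x0 t (bump j l).
Proof.
move=> jt; rewrite nth_cat (size_takel (ltnW jt)).
case: (ltnP l j) => lj; rewrite /bump.
  by rewrite leqNgt lj nth_take.
by rewrite lj nth_drop; congr nth; lia.
Qed.

Lemma perm_del (T : eqType) x0 (t : seq T) j : (j < size t)%N ->
  perm_eq (nth x0 t j :: del j t) t.
Proof.
move=> jt; rewrite -[X in perm_eq _ X](cat_take_drop j) (drop_nth x0 jt).
by rewrite -[_ :: del _ _]cat1s -cat1s perm_catCA.
Qed.

Lemma subseq_del (T : eqType) (t : seq T) j : (j < size t)%N -> subseq (del j t) t.
Proof.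
case: t => // x0 t jt; rewrite -[X in subseq _ X](cat_take_drop j);
  apply: cat_subseq => //.
by rewrite (drop_nth x0 jt); apply: subseq_cons.
Qed.

Lemma contractionE (T : Type) (A : T -> T -> R) x h (x0 : T) t :
  contraction A x h t = \sum_(j < size t) (-1) ^+ j * A x (nth x0 t j) * h (del j t).
Proof.
elim: t h => [|y t IH] h /=; first by rewrite big_ord0.
rewrite big_ord_recl /= /del /= drop0 expr0 mul1r; congr (_ + _).
rewrite IH -sumrN; apply: eq_bigr => j _.
by rewrite /bump add1n /= exprS; ring.
Qed.

Lemma contraction_cat0 (T : eqType) (G : T -> T -> R) x h s t :
  (forall y, y \in s -> G x y = 0) ->
  contraction G x h (s ++ t) = (-1) ^+ size s * contraction G x (fun u => h (s ++ u)) t.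
Proof.
elim: s h => [|y s IH] h Gs /=; first by rewrite mul1r.
rewrite Gs ?mem_head // mul0r sub0r IH ?exprS ?mulN1r ?mulNr //.
by move=> z zs; apply: Gs; rewrite inE zs orbT.
Qed.

Lemma contraction_rcons (T : Type) (G : T -> T -> R) x h t y :
  contraction G x h (rcons t y) =
  contraction G x (fun u => h (rcons u y)) t + (-1) ^+ size t * G x y * h t.
Proof.
elim: t h => [|z t IH] h /=; first by ring.
by rewrite IH exprS; ring.
Qed.

(** Reversing a list moves the entry in position j to position n - 1 - j, so the
two alternating signs differ by (-1)^(n - 1) for every j. *)
Lemma contraction_rev (T : Type) (G : T -> T -> R) x h t :
  contraction G x h (rev t) = (-1) ^+ (size t).-1 * contraction G x (fun u => h (rev u))
    t.
Proof.
elim: t h => [|y t IH] h; first by rewrite /= mulr0.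
rewrite rev_cons contraction_rcons IH /= size_rev.
rewrite (@eq_contraction _ _ G G x (fun u => h (rev (y :: u))) (fun u => h (rcons (rev u)
  y))) //; last first.
  by move=> u _; rewrite rev_cons.
by case: t {IH} => [|z t]; [rewrite /=; ring | rewrite /= exprS; ring].
Qed.

(** If G vanishes inside a, the expansion along the first entry of a only meets
entries of b and is the Laplace expansion along the first row.  With b reversed the
sign of the jump over the remaining entries of a cancels the one coming from the
reversal. *)
Lemma pf_det (T : eqType) (G : T -> T -> R) (x0 : T) n (a b : seq T) :
    size a = n -> size b = n ->
    (forall y z, y \in a -> z \in a -> G y z = 0) ->
  pf G (a ++ rev b) = \det (\matrix_(i < n, j < n) G (nth x0 a i) (nth x0 b j)).
Proof.
elim: n a b => [|n IH] [|x a] [|y b] //= sa sb Ga.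
  by rewrite det_mx00.
case: sa => sa; set b' := y :: b; have sb' : size b' = n.+1 by [].
rewrite pf_cons contraction_cat0; last first.
  by move=> z za; apply: Ga; rewrite ?mem_head // inE za orbT.
rewrite contraction_rev sa sb' mulrA -expr2 sqrr_sign mul1r (contractionE _ _ _ x0).
rewrite sb' (expand_det_row _ ord0); apply: eq_bigr => j _.
rewrite mxE /= (mulrC ((-1) ^+ j)) -mulrA; congr (_ * _).
rewrite /cofactor add0n; congr (_ * _).
rewrite IH //; first last.
- by move=> u z ua za; apply: Ga; rewrite inE ?ua ?za orbT.
- by apply/eqP; rewrite -eqSS size_del sb'.
congr (\det _); apply/matrixP => i l; rewrite !mxE nth_del ?sb' //.
Qed.

End PfaffianLists.

(** * The Pfaffian as a sum over permutations *)

Section PfaffianPerm.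
Variables (R : comNzRingType).

(** A permutation sending i0 to j0 is determined by its restriction to the other
points. *)
Lemma reindex_lift_perm n (i0 j0 : 'I_n.+1) (F : 'S_n.+1 -> R) :
  \sum_(s : 'S_n.+1 | s i0 == j0) F s = \sum_(u : 'S_n) F (lift_perm i0 j0 u).
Proof.
have inj : injective (@lift_perm n i0 j0).
  move=> u w /permP uw; apply/permP => l; apply: (@lift_inj _ j0).
  by rewrite -!(lift_perm_lift i0) uw.
transitivity (\sum_(s in lift_perm i0 j0 @: [set: 'S_n]%SET) F s); last first.
  rewrite big_imset /=; first by apply: eq_bigl => u; rewrite inE.
  by move=> u w _ _; apply: inj.
apply: eq_bigl => s; apply/eqP/imsetP => [sij|[u _ ->]]; last exact: lift_perm_id.
have [f fP] : exists f, forall l, lift j0 (f l) = s (lift i0 l).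
  apply: (@fin_all_exists _ _ (fun l m => lift j0 m = s (lift i0 l))) => l.
  have : j0 != s (lift i0 l) by rewrite -sij (inj_eq perm_inj) neq_lift.
  by case/unlift_some => m -> _; exists m.
have f_inj : injective f.
  by move=> l m lm; apply/(@lift_inj _ i0)/(@perm_inj _ s); rewrite -!fP lm.
exists (perm f_inj) => //; apply/permP => l.
by case: (unliftP i0 l) => [m|] ->; rewrite ?lift_perm_id // lift_perm_lift permE fP.
Qed.

Definition pf_term k (g : nat -> nat -> R) (s : 'S_k.*2) : R :=
  (-1) ^+ s * \prod_(i < k) g (s (ord_even i)) (s (ord_odd i)).

Definition pf_sum k (g : nat -> nat -> R) : R := \sum_(s : 'S_k.*2) pf_term g s.

(** The sign of the transposition is compensated by the antisymmetry of g. *)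
Lemma pf_term_tperm k (g : nat -> nat -> R) (i : 'I_k) s :
    (forall m n, g m n = - g n m) ->
  pf_term g (tperm (ord_even i) (ord_odd i) * s)%g = pf_term g s.
Proof.
move=> gN; rewrite /pf_term odd_permM odd_tperm.
have -> : (ord_even i != ord_odd i) = true.
  by apply/eqP => /(congr1 val) /=; lia.
rewrite signr_addb expr1 mulN1r !(bigD1 i (P := predT)) //= !permM tpermL tpermR.
rewrite (gN (s (ord_odd i))) !mulNr mulrN opprK; congr (_ * (_ * _)).
apply: eq_bigr => j ji; rewrite !permM !tpermD //;
  apply: contraNneq ji => /(congr1 val) /= ij;
  by apply/eqP/val_inj => /=; lia.
Qed.

(** Exchanging two blocks of positions {2 i, 2 i + 1} is an even permutation. *)
Lemma pf_term_block k (g : nat -> nat -> R) (i0 i : 'I_k) s :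
  pf_term g (tperm (ord_even i0) (ord_even i) * tperm (ord_odd i0) (ord_odd i) * s)%g =
  pf_term g s.
Proof.
rewrite /pf_term !odd_permM !odd_tperm.
have -> : (ord_even i0 != ord_even i) = (i0 != i).
  by congr (~~ _); apply/eqP/eqP => [/(congr1 val) /= e|-> //]; apply/val_inj => /=; lia.
rewrite addbb /=; congr (_ * _).
rewrite [RHS](reindex_inj (@perm_inj _ (tperm i0 i))) /=; apply: eq_bigr => j _.
have eo x y : ord_even x != ord_odd y :> 'I_k.*2 by apply/eqP => /(congr1 val) /=; lia.
have oe x y : ord_odd x != ord_even y :> 'I_k.*2 by rewrite eq_sym.
have ee x y : x != y -> ord_even x != ord_even y :> 'I_k.*2.
  by apply: contraNneq => /(congr1 val) /= e; apply/eqP/val_inj => /=; lia.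
have oo x y : x != y -> ord_odd x != ord_odd y :> 'I_k.*2.
  by apply: contraNneq => /(congr1 val) /= e; apply/eqP/val_inj => /=; lia.
rewrite !permM; case: tpermP => [->|->|/eqP ji0 /eqP ji].
- rewrite tpermL (tpermD (x := ord_odd i0)) ?oe ?eo //.
  by rewrite (tpermD (x := ord_even i0)) // tpermL.
- rewrite tpermR (tpermD (x := ord_odd i0)) ?oe ?eo //.
  by rewrite (tpermD (x := ord_even i0)) // tpermR.
rewrite !tpermD ?ee ?oo ?oe ?eo // 1?eq_sym //.
Qed.

(** By the invariances under permutations inside and between blocks, the position
where the value 0 is taken does not matter, which gives the factor 2 (k + 1);
then the sum is split according to the value at the other position of the
first block. *)
Lemma pf_sum_rec k (g : nat -> nat -> R) :
    (forall m n, g m n = - g n m) ->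
  pf_sum k.+1 g = (k.+1.*2)%:R * \sum_(j < k.*2.+1) (-1) ^+ j * g 0 j.+1 *
     pf_sum k (fun m n => g (bump j m).+1 (bump j n).+1).
Proof.
move=> gN; rewrite /pf_sum.
pose z : 'I_(k.+1.*2) := ord_even ord0.
rewrite (partition_big (fun s : 'S_k.+1.*2 => (s^-1)%g z) predT) //=.
(* Any position p can be moved to position 0 by a swap inside its block and
   an exchange of blocks. *)
have Hp p : exists2 t : 'S_k.+1.*2, t p = z & forall s, pf_term g (t * s)%g = pf_term g s.
  pose i : 'I_k.+1 := inord p./2.
  have iE : i = p./2 :> nat by rewrite inordK //; have := ltn_ord p; lia.
  pose b := (tperm (ord_even ord0) (ord_even i) * tperm (ord_odd ord0) (ord_odd i))%g.
  have bz : b (ord_even i) = z.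
    by rewrite permM tpermR tpermD //; apply/eqP => /(congr1 val) /=; lia.
  have [op|ep] := boolP (odd p).
    have -> : p = ord_odd i by apply/val_inj => /=; lia.
    exists (tperm (ord_even i) (ord_odd i) * b)%g => [|s].
      by rewrite permM tpermR.
    by rewrite -mulgA pf_term_tperm // pf_term_block.
  have -> : p = ord_even i by apply/val_inj => /=; lia.
  by exists b => // s; rewrite pf_term_block.
transitivity (\sum_(p < k.+1.*2) \sum_(s : 'S_k.+1.*2 | s z == z) pf_term g s).
  apply: eq_bigr => p _; have [t tp ft] := Hp p.
  rewrite (reindex_inj (mulgI t)) /=; apply: eq_big => [s|s _]; last exact: ft.
  by rewrite invMg permM (can2_eq (permKV t) (permK t)) tp (can2_eq (permKV s) (permK s))
    eq_sym.
rewrite sumr_const card_ord -[LHS]mulr_natl; congr (_ * _).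
rewrite (@reindex_lift_perm k.*2.+1 z z).
rewrite (partition_big (fun s : 'S_k.*2.+1 => s ord0) predT) //=.
apply: eq_bigr => j _; rewrite (reindex_lift_perm ord0 j) mulr_sumr.
apply: eq_bigr => w _; rewrite /pf_term !odd_lift_perm /=.
rewrite big_ord_recl signr_addb signr_odd mulrACA; congr (_ * _ * (_ * _)).
- have -> : ord_even ord0 = z by [].
  have -> : ord_odd ord0 = lift z ord0 :> 'I_k.+1.*2 by apply: val_inj.
  by rewrite lift_perm_lift !lift_perm_id.
apply: eq_bigr => i _.
have -> : ord_even (lift ord0 i) = lift z (lift ord0 (ord_even i)) :> 'I_k.+1.*2.
  by apply: val_inj.
have -> : ord_odd (lift ord0 i) = lift z (lift ord0 (ord_odd i)) :> 'I_k.+1.*2.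
  by apply: val_inj.
by rewrite !lift_perm_lift.
Qed.

Definition skew_kernel (T : Type) (K : T -> T -> R) (x0 : T) (t : seq T) (i j : nat) : R
  :=
  if (i < j)%N then K (nth x0 t i) (nth x0 t j)
  else if (j < i)%N then - K (nth x0 t j) (nth x0 t i) else 0.

Lemma pf_sumE (T : Type) (K : T -> T -> R) (x0 : T) k (t : seq T) :
  size t = k.*2 -> pf_sum k (skew_kernel K x0 t) = (2 ^ k * k`!)%:R * pf K t.
Proof.
elim: k t => [|k IH] t st.
  case: t st => // _; rewrite /pf_sum /pf_term.
  under eq_bigr do rewrite big_ord0 mulr1.
  rewrite (big_pred1 1%g) ?odd_perm1 ?mulr1 //.
  by move=> s; rewrite /=; apply/esym/eqP/permP => -[].
rewrite pf_sum_rec; last first.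
  move=> m n; rewrite /skew_kernel; case: ltngtP; rewrite ?opprK ?oppr0 //.
case: t st => // x t; rewrite doubleS => -[st].
rewrite pf_cons (contractionE _ _ _ x0) st expnS factS mulnACA natrM mul2n -mulrA;
  congr (_ * _).
rewrite mulr_sumr; apply: eq_bigr => j _; rewrite mulrCA; congr (_ * _).
rewrite -IH; last by apply/eqP; rewrite -eqSS size_del ?st.
apply: eq_bigr => s _; congr (_ * _); apply: eq_bigr => i _.
rewrite /skew_kernel !ltnS /= !nth_del ?st //.
have bl m n : (bump j m < bump j n)%N = (m < n)%N by rewrite /bump; lia.
by rewrite !bl.
Qed.

End PfaffianPerm.

Lemma pfaffian_pf (R : numFieldType) (T : Type) (K : T -> T -> R) (k : nat)
    (v : (k.*2).-tuple T) (M : 'M[R]_k.*2) :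
    (forall i j, M i j = if (i < j)%N then K (tnth v i) (tnth v j)
                 else if (j < i)%N then - K (tnth v j) (tnth v i) else 0) ->
  pfaffian M = pf K v.
Proof.
move=> ME; rewrite /pfaffian; set N := (_ * _)%:R.
have N0 : N != 0 :> R by rewrite pnatr_eq0 muln_eq0 negb_or expn_eq0 /= -lt0n fact_gt0.
case: k v M ME @N N0 => [|k] v M ME N N0.
  rewrite (tuple0 v) pf_nil (big_pred1 1%g); last first.
    by move=> s; rewrite /=; apply/esym/eqP/permP => -[].
  by rewrite big_ord0 odd_perm1 /= mulr1 divff.
have x0 : T := tnth v (ord_even ord0).
rewrite -[pf K v](mulKf N0) -(pf_sumE K x0) ?size_tuple // mulrC; congr (_ * _).
apply: eq_bigr => s _; congr (_ * _); apply: eq_bigr => i _.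
by rewrite ME /skew_kernel !(tnth_nth x0).
Qed.

(** * Noncrossing partitions with even classes *)

Section Noncrossing.
Variables (T : eqType) (r : rel T).
Hypotheses (rxx : reflexive r) (rC : symmetric r) (rtr : transitive r).

Definition noncrossing (s : seq T) :=
  forall x y z w, subseq [:: x; y; z; w] s -> r x z -> r y w -> r x y.

Lemma noncrossing_sub s t : subseq t s -> noncrossing s -> noncrossing t.
Proof. by move=> ts ns x y z w st; apply: ns; apply: subseq_trans st ts. Qed.

Lemma count_class x y s : r x y -> count (r x) s = count (r y) s.
Proof.
move=> xy; apply: eq_count => z; apply/idP/idP; last exact: rtr.
by apply: rtr; rewrite rC.
Qed.

Definition even_classes (s : seq T) := all (fun x => ~~ odd (count (r x) s)) s.

(** A class that does not meet s is counted 0 times in s. *)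
Lemma even_classesP s :
  reflect (forall x, ~~ odd (count (r x) s)) (even_classes s).
Proof.
apply: (iffP allP) => [ev x|ev x _]; last exact: ev.
have [/hasP[y ys xy]|] := boolP (has (r x) s);
  last by rewrite has_count -eqn0Ngt => /eqP ->.
by rewrite (count_class _ xy); apply: ev.
Qed.

Lemma even_size s : (forall x, ~~ odd (count (r x) s)) -> ~~ odd (size s).
Proof.
have [n] := ubnP (size s); elim: n s => // n IH [|x t] // sn ev.
set s := x :: t; rewrite -/s in sn ev *.
rewrite -(count_predC (r x) s) oddD (negbTE (ev x)) addFb -size_filter.
apply: IH => [|z].
  rewrite -ltnS; apply: leq_trans sn; rewrite ltnS size_filter -(count_predC (r x) s).
  by rewrite -[X in (X < _)%N]add0n ltn_add2r -has_count /= rxx.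
rewrite count_filter; have [xz|xz] := boolP (r x z).
  rewrite (@eq_count _ _ pred0) ?count_pred0 // => y /=.
  apply/negP => /andP[zy /negP[]]; exact: rtr xz zy.
rewrite (@eq_count _ _ (r z)) ?ev // => y /=.
apply/andb_idr => zy; apply: contraNN xz => xy.
by apply: rtr xy _; rewrite rC.
Qed.

Section Alternating.
Variable (R : comNzRingType).

Definition link_kernel (x y : T) : R := (r x y)%:R.

(** The entries of a class that come between two consecutive occurrences of the
class of x form whole classes, because of the noncrossing property; so they are
even in number and the occurrences of the class of x sit at positions of
alternating parity.  The alternating sum is then 1 - 1 + 1 ... *)
Lemma contraction_class x s :
    noncrossing (x :: s) ->
    (forall z, ~~ r x z -> ~~ odd (count (r z) s)) ->
  contraction link_kernel x (fun=> 1) s = (odd (count (r x) s))%:R.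
Proof.
have [n] := ubnP (size s); elim: n s => // n IH s sn nc ev.
have G0 s' : ~~ has (r x) s' -> forall y, y \in s' -> link_kernel x y = 0.
  by move=> /hasPn h y ys; rewrite /link_kernel (negbTE (h y ys)).
(* s is cut at the first element y of the class of x. *)
have [hs|hs] := boolP (has (r x) s); last first.
  rewrite -[s]cats0 contraction_cat0 ?mulr0 ?cats0; last exact: G0.
  by move: hs; rewrite has_count -eqn0Ngt => /eqP ->.
case: (split_find hs) sn nc ev => y s0 s1 xy hs0; rewrite -cats1 -catA /= => sn nc ev.
rewrite contraction_cat0 /=; last exact: G0.
rewrite {1}/link_kernel xy mul1r.
have cross u v : u \in s0 -> v \in s1 -> ~~ r u v.
  move=> us vs; apply/negP => uv; move/hasPn: hs0 => /(_ u us) /negP; apply.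
  apply: (nc x u y v) xy uv; rewrite /= eqxx.
  apply: (@cat_subseq _ [:: u] [:: y; v]); rewrite ?sub1seq //.
  by rewrite /= eqxx sub1seq.
have ev0 z : ~~ odd (count (r z) s0).
  have [xz|xz] := boolP (r x z).
    by rewrite -(count_class _ xz); move: hs0; rewrite has_count -eqn0Ngt => /eqP ->.
  have [/hasP[u us zu]|] := boolP (has (r z) s0);
    last by rewrite has_count -eqn0Ngt => /eqP ->.
  have := ev z xz; rewrite count_cat /= [r z y](_ : _ = false); last first.
    by apply: contraNF xz => zy; apply: rtr xy _; rewrite rC.
  suff -> : count (r z) s1 = 0%N by rewrite !addn0.
  apply/eqP; rewrite eqn0Ngt -has_count; apply/hasPn => v vs;
    apply: contraNN (cross u v us vs) => zv.
  by apply: rtr zv; rewrite rC.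
rewrite -signr_odd (negbTE (even_size ev0)) mul1r IH.
- rewrite count_cat /= xy !oddD (negbTE (ev0 x)) /=.
  by case: (odd _); rewrite ?subrr ?subr0.
- by move: sn; rewrite size_cat /=; lia.
- apply: noncrossing_sub nc; rewrite /= eqxx.
  by apply: subseq_trans (suffix_subseq _ _); apply: subseq_cons.
move=> z xz; have := ev z xz; rewrite count_cat /= [r z y](_ : _ = false); last first.
  by apply: contraNF xz => zy; apply: rtr xy _; rewrite rC.
by rewrite add0n oddD (negbTE (ev0 z)).
Qed.

(** Removing two equivalent entries does not change the parity of any class, so
in the expansion along x all the nonzero terms agree up to sign, and the signs
add up to 1 by the alternation property. *)
Lemma pf_link s : noncrossing s -> pf link_kernel s = (even_classes s)%:R.
Proof.
have [n] := ubnP (size s); elim: n s => // n IH [|x t] //= sn nc.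
rewrite pf_cons.
have nct : noncrossing t by apply: noncrossing_sub nc; apply: subseq_cons.
transitivity ((even_classes (x :: t))%:R * contraction link_kernel x (fun=> 1) t).
  rewrite -contractionZ !(contractionE _ _ _ x); apply: eq_bigr => j _.
  rewrite /link_kernel; case: (boolP (r x _)) => xj; last by rewrite !mulr0 !mul0r.
  rewrite mulr1; congr (_ * _).
  have dsub := subseq_del (ltn_ord j).
  rewrite IH; last exact: noncrossing_sub dsub nct.
    have dperm := perm_del x (ltn_ord j).
    congr (_%:R); congr nat_of_bool; apply/even_classesP/even_classesP => ev z;
      have := ev z;
      rewrite /= -(seq.permP dperm) /= (_ : r z x = r z (nth x t j)) ?oddD ?addKb //.
      by rewrite !(rC z); apply/idP/idP => h; [rewrite rC; apply: rtr _ xj;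
        rewrite rC | apply: rtr xj h].
    by rewrite !(rC z); apply/idP/idP => h; [rewrite rC; apply: rtr _ xj;
      rewrite rC | apply: rtr xj h].
  have := size_del (ltn_ord j); lia.
have [/even_classesP ev|_] := boolP (even_classes _); last by rewrite mul0r.
rewrite mul1r contraction_class //.
  by have := ev x; rewrite /= rxx /= negbK => ->.
by move=> z xz; have := ev z; rewrite /= rC (negbTE xz).
Qed.

End Alternating.
End Noncrossing.

Section ParallelClasses.
Variables (V : eqType) (r : rel V).
Hypotheses (rxx : reflexive r) (rC : symmetric r) (rtr : transitive r).

Lemma subseq_nth2 (x0 : V) (s : seq V) i j :
  (i < j < size s)%N -> subseq [:: nth x0 s i; nth x0 s j] s.
Proof.
move=> /andP[ij js]; rewrite -[X in subseq _ X](cat_take_drop j).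
apply: (@cat_subseq _ [:: _] [:: _]); rewrite sub1seq.
  by rewrite -(nth_take x0 ij) mem_nth // size_take js.
by rewrite (drop_nth x0 js) mem_head.
Qed.

Lemma nth_codom_ord n (f : 'I_n -> V) x0 (i : 'I_n) : nth x0 (codom f) i = f i.
Proof. by rewrite codomE (nth_map i) ?size_enum_ord // nth_ord_enum. Qed.

(** An increasing map moves point i at least i steps from the left end and leaves
room for n - 1 - i steps to the right end. *)
Lemma increasing_ord_id n (p : 'I_n -> 'I_n) :
  (forall i j : 'I_n, (i < j)%N -> (p i < p j)%N) -> forall i, p i = i.
Proof.
move=> pI.
have step d (i j : 'I_n) : (i + d)%N = j -> (p i + d <= p j)%N.
  elim: d j => [|d IH] j ij; first by rewrite addn0 (_ : i = j) //; apply: val_inj;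
    rewrite /= -ij addn0.
  have lt : (i + d < n)%N by have := ltn_ord j; lia.
  have := IH (Ordinal lt) erefl; have : (p (Ordinal lt) < p j)%N by apply: pI => /=; lia.
  lia.
move=> i; apply: val_inj => /=.
have n0 : (0 < n)%N by have := ltn_ord i; lia.
have nn : (n.-1 < n)%N by lia.
have := step i (Ordinal n0) i erefl.
have := step (n.-1 - i)%N i (Ordinal nn).
have := ltn_ord (p (Ordinal nn)); have := ltn_ord i => /=; lia.
Qed.

Variables (n : nat) (a b : 'I_n -> V).

Definition parallel_classes :=
  [forall i, r (a i) (b i)] && [forall i, forall j, (i != j) ==> ~~ r (a i) (b j)].

Let s := codom a ++ rev (codom b).

(** If two elements of a, or two elements of b, are equivalent, the matrix has two
equal rows or columns.  Otherwise each class, being even, is a pair {a_i, b_(p i)},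
and p is increasing, for a_i, a_j, b_(p i), b_(p j) would cross if i < j and
p j < p i.  So p is the identity, and so is the matrix. *)
Lemma det_parallel_classes (R : comNzRingType) :
    noncrossing r s -> even_classes r s ->
  \det (\matrix_(i < n, j < n) (r (a i) (b j))%:R) = parallel_classes%:R :> R.
Proof.
move=> nc /(even_classesP rC rtr) ev; set M := \matrix_(_, _) _.
have [/andP[/forallP par /forallP npar]|npar] := boolP parallel_classes.
  have -> : M = 1%:M.
    apply/matrixP => i j; rewrite !mxE; case: eqP => [<-|/eqP ij]; first by rewrite par.
    by have /forallP/(_ j) := npar i; rewrite ij /= => /negbTE ->.
  by rewrite det1.
have [/existsP[i /existsP[j /andP[ij aij]]]|/existsPn inja] :=
  boolP [exists i, exists j, (i != j) && r (a i) (a j)].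
  rewrite (determinant_alternate ij) // => l; rewrite !mxE; congr (_%:R);
    congr nat_of_bool.
  by apply/idP/idP; apply: rtr; rewrite // rC.
have [/existsP[i /existsP[j /andP[ij bij]]]|/existsPn injb] :=
  boolP [exists i, exists j, (i != j) && r (b i) (b j)].
  rewrite -det_tr (determinant_alternate ij) // => l; rewrite !mxE; congr (_%:R);
    congr nat_of_bool.
  by rewrite !(rC (a l)); apply/idP/idP; apply: rtr; rewrite // rC.
case/negP: npar.
have aE i j : r (a i) (a j) = (i == j).
  apply/idP/eqP => [aij|->]; last exact: rxx.
  by apply/eqP; apply: contraTT aij => ij; have /existsPn/(_ j) := inja i; rewrite ij.
have bE i j : r (b i) (b j) = (i == j).
  apply/idP/eqP => [bij|->]; last exact: rxx.
  by apply/eqP; apply: contraTT bij => ij; have /existsPn/(_ j) := injb i; rewrite ij.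
have /fin_all_exists[p pP] : forall i, exists j, r (a i) (b j).
  move=> i; have := ev (a i); rewrite count_cat count_rev.
  have -> : count (r (a i)) (codom a) = 1%N.
    rewrite codomE count_map (eq_count (a2 := pred1 i)) => [|j];
      last by rewrite /= aE eq_sym.
    by rewrite count_uniq_mem ?enum_uniq // mem_enum.
  rewrite add1n /= negbK => od; have : has (r (a i)) (codom b).
    by rewrite has_count; case: (count _ _) od.
  by case/hasP => _ /codomP[j ->] rij; exists j.
have pid : forall i, p i = i.
  apply: increasing_ord_id => i j ij; rewrite ltnNge leq_eqVlt;
    apply/negP => /orP[/eqP pij|pji].
    have := aE i j; rewrite (_ : (i == j) = false); last by apply/eqP => e;
      rewrite e ltnn in ij.
    move=> /negP; apply; apply: rtr (pP i) _; rewrite rC (_ : p i = p j) //.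
    by apply: val_inj.
  have := aE i j; rewrite (_ : (i == j) = false); last by apply/eqP => e;
    rewrite e ltnn in ij.
  move=> /negP; apply; apply: (nc _ _ (b (p i)) (b (p j))) (pP i) (pP j).
  apply: (@cat_subseq _ [:: _; _] [:: _; _]).
    have := @subseq_nth2 (a i) (codom a) i j; rewrite !nth_codom_ord => -> //.
    by rewrite ij size_codom card_ord ltn_ord.
  rewrite -[[:: _; _]]/(rev [:: b (p j); b (p i)]) subseq_rev.
  have := @subseq_nth2 (a i) (codom b) (p j) (p i); rewrite !nth_codom_ord => -> //.
  by rewrite pji size_codom card_ord ltn_ord.
apply/andP; split; apply/forallP => i; first by rewrite -{2}(pid i).
apply/forallP => j; apply/implyP => ij; apply/negP => aij.
have := bE i j; rewrite (negbTE ij) => /negP; apply; apply: rtr aij.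
by rewrite rC -{2}(pid i).
Qed.

End ParallelClasses.

(** * Boundaries of edge sets modulo two *)

Section Boundary.
Variables (V : finType) (E : {set {set V}}).
Implicit Types (p q O : {ffun edge E -> bool}) (f g : {ffun V -> bool}) (s t : seq V).

Definition boundary p : {ffun V -> bool} :=
  [ffun x => \sum_(e : edge E | x \in val e) p e].

(** Sets of sources are handled modulo two, as functions with values in the field
bool, which turns symmetric differences into sums. *)
Definition parity s : {ffun V -> bool} := [ffun x => odd (count_mem x s)].

Definition link O : rel V :=
  connect (fun u v => [exists e : edge E, (val e == [set u; v]%SET) && O e]).

Definition inside p O := [forall e, p e ==> O e].

Lemma boundaryD p q : boundary (p + q) = boundary p + boundary q.
Proof.
apply/ffunP => x; rewrite !ffunE -big_split /=; apply: eq_bigr => e _.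
by rewrite ffunE.
Qed.

Lemma boundary0 : boundary 0 = 0.
Proof. by apply/ffunP => x; rewrite !ffunE big1 // => e _; rewrite ffunE. Qed.

Lemma boundary_sum (I : finType) (P : pred I) (F : I -> {ffun edge E -> bool}) :
  boundary (\sum_(i | P i) F i) = \sum_(i | P i) boundary (F i).
Proof. exact: (big_morph _ boundaryD boundary0). Qed.

Lemma parity_cat s t : parity (s ++ t) = parity s + parity t.
Proof. by apply/ffunP => x; rewrite !ffunE count_cat oddD. Qed.

Lemma parity_nil : parity [::] = 0.
Proof. by apply/ffunP => x; rewrite !ffunE. Qed.

Lemma parity_perm s t : perm_eq s t -> parity s = parity t.
Proof. by move=> st; apply/ffunP => x; rewrite !ffunE (seq.permP st). Qed.

Lemma parity_sum s (P : pred V) : \sum_(y | P y) parity s y = odd (count P s).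
Proof.
elim: s => [|x s IH]; first by rewrite big1 // => y _; rewrite ffunE.
under eq_bigr => y _ do rewrite -cat1s parity_cat ffunE.
rewrite big_split /= IH oddD; congr (_ (+) _).
rewrite (big_mkcond P) (bigD1 x) //= big1 ?addr0 => [|y /negbTE yx].
  by rewrite ffunE /= eqxx; case: (P x).
by rewrite ffunE /= eq_sym yx; case: ifP.
Qed.

Lemma ffun_boolD (T : finType) (f1 f2 : {ffun T -> bool}) x : (f1 + f2) x = f1 x (+) f2 x.
Proof. by rewrite ffunE. Qed.

Lemma ffun_boolDK (T : finType) (f1 f2 : {ffun T -> bool}) : f1 + f2 + f2 = f1.
Proof. by apply/ffunP => x; rewrite !ffun_boolD addbK. Qed.

Lemma link_refl O : reflexive (link O). Proof. by move=> x; apply: connect0. Qed.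

Lemma link_trans O : transitive (link O). Proof. exact: connect_trans. Qed.

Lemma link_sym O : symmetric (link O).
Proof.
apply: sym_connect_sym => u v; apply: eq_existsb => e; congr ((val e == _) && _).
exact: finset.setUC.
Qed.

Lemma link_edge O e u v : O e -> val e = [set u; v]%SET -> link O u v.
Proof. by move=> Oe euv; apply/connect1/existsP; exists e; rewrite euv eqxx Oe. Qed.

Lemma insideD p q O : inside p O -> inside q O -> inside (p + q) O.
Proof.
move=> /forallP pO /forallP qO; apply/forallP => e; apply/implyP; rewrite ffun_boolD.
by case: (boolP (p e)) => [/(implyP (pO e)) //|_ /= qe]; apply: (implyP (qO e)).
Qed.

Lemma inside_sum (I : finType) (P : pred I) (F : I -> {ffun edge E -> bool}) O :
  (forall i, P i -> inside (F i) O) -> inside (\sum_(i | P i) F i) O.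
Proof.
move=> FO; apply: (big_ind (fun p => inside p O)) => //; last by move=> p q;
  apply: insideD.
by apply/forallP => e; rewrite ffunE.
Qed.

Hypothesis hE : simple_graph E.

Lemma card_edge (e : edge E) : #|val e| = 2%N. Proof. exact: hE (valP e). Qed.

Lemma edgeP (e : edge E) : exists x y, x != y /\ val e = [set x; y]%SET.
Proof.
by have /eqP/cards2P[x [y [xy exy]]] := card_edge e; exists x, y.
Qed.

(** Handshake lemma: each edge of p has both ends or no end in a given cluster. *)
Lemma boundary_even p O x :
  inside p O -> \sum_(y | link O x y) boundary p y = 0.
Proof.
move=> /forallP pO; under eq_bigr do rewrite ffunE.
rewrite (exchange_big_dep predT) // big1 // => e _.
have [pe|/negbTE npe] := boolP (p e); last exact: big1.
have Oe := implyP (pO e) pe; have [u [v [uv euv]]] := edgeP e.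
have luv : link O x u = link O x v := same_connect_r (@link_sym O) (link_edge Oe euv) x.
rewrite (eq_bigl (fun y => (y \in [set u; v]%SET) && link O x u)); last first.
  move=> y; rewrite euv !inE; case: eqP => [->|_]; first by rewrite andbT.
  by case: eqP => [->|_] /=; rewrite ?andbT ?andbF // luv.
have [_|_] := boolP (link O x u); last by rewrite big1 // => y; rewrite andbF.
rewrite (eq_bigl [in [set u; v]%SET]) => [|y]; last by rewrite andbT.
by rewrite big_setU1 ?inE //= big_set1; apply: addrr_pchar2.
Qed.

(** The edges of a path, modulo two; they stay in the cluster of x. *)
Lemma link_path O x y : link O x y ->
  exists p, [/\ inside p O, boundary p = parity [:: x; y] &
                forall e z, p e -> z \in val e -> link O x z].
Proof.
move=> /connectP[s es ->] {y}; elim: s x es => [|x' s IH] x /=.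
  move=> _; exists 0; split; first by apply/forallP => e; rewrite ffunE.
    by rewrite boundary0; apply/ffunP => z; rewrite !ffunE /= addn0 addnn odd_double.
  by move=> e z; rewrite ffunE.
move=> /andP[/existsP[e0 /andP[/eqP e0E' Oe0]] es].
have e0E : val e0 = [set x; x']%SET := e0E'.
have [p [pO bp pl]] := IH _ es.
have lxx' := link_edge Oe0 e0E.
have xx' : x != x'.
  by apply/eqP => xx'; have := card_edge e0; rewrite e0E xx' finset.setUid cards1.
pose q : {ffun edge E -> bool} := [ffun e => e == e0].
have bq : boundary q = parity [:: x; x'].
  apply/ffunP => z; rewrite !ffunE /= addn0 oddD big_mkcond (bigD1 e0) //= big1 ?addr0.
    rewrite e0E !inE ffunE eqxx !(eq_sym z).
    by case: (eqVneq x z) => [<-|_]; [rewrite eq_sym (negbTE xx') | case: eqP].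
  by move=> e /negbTE e0e; rewrite ffunE e0e; case: ifP.
exists (q + p); split.
- apply: insideD pO; apply/forallP => e; rewrite ffunE.
  by apply/implyP => /eqP ->.
- rewrite boundaryD bq bp; apply/ffunP => z; rewrite ffun_boolD !ffunE /= !addn0 !oddD.
  by rewrite addbA addbK.
move=> e z; rewrite ffun_boolD ffunE; have [-> _ ze|_ pe ze] := eqVneq e e0.
  have {ze} : z \in val e0 by [].
  by rewrite e0E !inE => /orP[] /eqP ->; [apply: link_refl | apply: lxx'].
by apply: link_trans lxx' _; apply: pl pe ze.
Qed.

(** Each vertex y with f y is reached by a path from the representative t y of its
cluster.  A representative is the starting point of an even number of these paths, so
that the starting points cancel. *)
Lemma boundary_onto O f :
    (forall x, \sum_(y | link O x y) f y = 0) ->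
  exists2 p, inside p O & boundary p = f.
Proof.
move=> fO.
have [rt rtP] : exists rt : V -> V, forall y z, link O y z = (rt y == rt z).
  exists (fingraph.root (fun u v => [exists e : edge E, (val e == [set u;
    v]%SET) && O e])) => y z.
  by rewrite root_connect //; apply: (@link_sym O).
pose t (y : V) : V := odflt y [pick z | rt z == rt y].
have rtt y : rt (t y) = rt y by rewrite /t; case: pickP => //= z /eqP.
have tE y z : rt y = rt z -> t y = t z.
  by move=> yz; rewrite /t yz; case: pickP => // /(_ z); rewrite eqxx.
have lrt y : link O (t y) y by rewrite rtP rtt eqxx.
have [P PP] := fin_all_exists (fun y => link_path (lrt y)).
exists (\sum_(y | f y) P y); first by apply: inside_sum => y _; have [] := PP y.
rewrite boundary_sum (eq_bigr (fun y => parity [:: t y] + parity [:: y])); last first.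
  by move=> y _; have [_ -> _] := PP y; rewrite -parity_cat.
rewrite big_split /=; apply/ffunP => x; rewrite ffun_boolD !sum_ffunE.
have -> : \sum_(y | f y) parity [:: y] x = f x.
  rewrite big_mkcond (bigD1 x) //= big1 ?addr0; first by rewrite ffunE /= eqxx;
    case: (f x).
  by move=> y yx; rewrite ffunE /= (negbTE yx); case: ifP.
suff -> : \sum_(y | f y) parity [:: t y] x = false by [].
have [tx|tx] := eqVneq (t x) x; last first.
  rewrite big1 // => y _; rewrite ffunE /= addn0; case: eqP => // tyx.
  by case/eqP: tx; rewrite -[in RHS]tyx -tyx; apply: tE; rewrite rtt.
rewrite -[RHS](fO x) big_mkcond [RHS]big_mkcond; apply: eq_bigr => y _.
rewrite ffunE /= addn0 rtP; case: (f y); last by case: ifP.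
have -> : (rt x == rt y) = (t y == x); last by case: eqP.
by apply/eqP/eqP => [/tE <- //|<-]; rewrite rtt.
Qed.

End Boundary.

(** * Planarity: cycles are boundaries of faces *)

(** All the fibres of an additive map are translates of its kernel. *)
Lemma card_additive (T1 T2 : finType) (f : {ffun T1 -> bool} -> {ffun T2 -> bool}) :
    ({morph f : g h / g + h}) ->
  (2 ^ #|T1| = #|[set f g | g in [set: {ffun T1 -> bool}]%SET]%SET| * #|[set g | f g ==
    0%R]%SET|)%N.
Proof.
move=> fD.
have <- : #|{ffun T1 -> bool}| = (2 ^ #|T1|)%N by rewrite card_ffun card_bool.
rewrite -[LHS]sum1_card (partition_big f (mem [set f g | g in [set: {ffun T1 ->
  bool}]%SET]%SET)) /=; last first.
  by move=> g _; apply: imset_f.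
rewrite -sum_nat_const; apply: eq_bigr => _ /imsetP[g0 _ ->].
rewrite -sum1_card (reindex_inj (addrI g0)) /=; apply: eq_bigl => g.
by rewrite inE fD -subr_eq0 addrAC subrr add0r.
Qed.

Section Planarity.
Variables (V : finType) (E : {set {set V}}) (rho : {perm dart E}).
Hypotheses (hE : simple_graph E) (hconn : connected_graph E).
Hypothesis hplane : plane_embedding rho.

Let phi := face_next rho.

Definition edge_of (d : dart E) : edge E :=
  exist (fun e : {set V} => e \in E) [set (val d).1; (val d).2]%SET (valP d).

Definition target (d : dart E) : V := (val d).2.

Lemma drevK : involutive (@drev V E).
Proof. by move=> d; apply: val_inj => /=; case: (val d). Qed.

Lemma edge_of_drev d : edge_of (drev d) = edge_of d.
Proof. by apply: val_inj; rewrite /= finset.setUC. Qed.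

Lemma val_edge_of d : val (edge_of d) = [set origin d; target d]%SET.
Proof. by []. Qed.

Lemma origin_target d : origin d != target d.
Proof.
apply/eqP => ot; have := card_edge hE (edge_of d).
by rewrite val_edge_of ot finset.setUid cards1.
Qed.

Lemma rho_origin d : origin (rho d) = origin d.
Proof. by have [h _] := hplane; apply/esym/eqP; rewrite -h fconnect1. Qed.

Lemma phi_origin d : origin (phi d) = target d.
Proof. by rewrite /phi /face_next rho_origin. Qed.

Lemma phi_drev d : phi (drev d) = rho d.
Proof. by rewrite /phi /face_next drevK. Qed.

Lemma phi_inj : injective phi.
Proof. by move=> d d' /perm_inj/(can_inj drevK). Qed.

Lemma edge_dart (e : edge E) x : x \in val e ->
  exists d, [/\ edge_of d = e, origin d = x & forall d', edge_of d' = e ->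
    origin d' = x -> d' = d].
Proof.
move=> xe; have [y [yx eE]] : exists y, y != x /\ val e = [set x; y]%SET.
  have [u [v [uv euv]]] := edgeP hE e; move: xe; rewrite euv !inE => /orP[]/eqP ->.
    by exists v; rewrite eq_sym.
  by exists u; rewrite finset.setUC.
have xyE : [set x; y]%SET \in E by rewrite -eE; apply: valP.
exists (exist (fun p : V * V => [set p.1; p.2]%SET \in E) (x, y) xyE); split => //.
  by apply: val_inj; rewrite /= eE.
move=> d' d'e d'x; apply: val_inj => /=.
have := val_edge_of d'; rewrite d'e eE d'x => h.
have : y \in [set x; target d']%SET by rewrite -h !inE eqxx orbT.
by rewrite !inE (negbTE yx) /= => /eqP ->; rewrite -d'x; apply: surjective_pairing.
Qed.

Lemma boundary_dart (p : {ffun edge E -> bool}) x :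
  boundary p x = \sum_(d | origin d == x) p (edge_of d).
Proof.
rewrite ffunE (partition_big edge_of (fun e : edge E => x \in val e)) /=; last first.
  by move=> d /eqP <-; rewrite !inE eqxx.
apply: eq_bigr => e xe; have [d [de dx dU]] := edge_dart xe.
rewrite (big_pred1 d) ?de // => d' /=; apply/andP/eqP => [[/eqP ? /eqP ?]|->];
  first exact: dU.
by rewrite de dx !eqxx.
Qed.

(** The edges whose two sides carry different values of h, where h d is the colour
of the corner just before d, on the right-hand side of d. *)
Definition coboundary (h : {ffun dart E -> bool}) : {ffun edge E -> bool} :=
  [ffun e => \sum_(d | edge_of d == e) h d].

Lemma coboundaryD g h : coboundary (g + h) = coboundary g + coboundary h.
Proof.
apply/ffunP => e; rewrite !ffunE -big_split /=; apply: eq_bigr => d _.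
by rewrite ffunE.
Qed.

Lemma coboundaryE h d : coboundary h (edge_of d) = h d + h (drev d).
Proof.
have dd : drev d != d.
  by apply/eqP => dd; have := origin_target d; rewrite -[in target _]dd eqxx.
rewrite ffunE (bigD1 d) //=; congr (_ + _); rewrite (big_pred1 (drev d)) // => d' /=.
apply/andP/eqP => [[/eqP e d'd]|->]; last by rewrite edge_of_drev.
have od : origin d \in val (edge_of d) by rewrite val_edge_of !inE eqxx.
have td : target d \in val (edge_of d) by rewrite val_edge_of !inE eqxx orbT.
have := val_edge_of d'; rewrite e => e'.
have : origin d' \in val (edge_of d) by rewrite e' !inE eqxx.
rewrite val_edge_of !inE => /orP[]/eqP o.
  have [d0 [_ _ dU]] := edge_dart od.
  by case/eqP: d'd; rewrite (dU _ e o) (dU d).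
have [d0 [_ _ dU]] := edge_dart td.
by rewrite (dU _ e o) (dU (drev d)) ?edge_of_drev.
Qed.

(** Walking around a vertex x, the colour changes once at each edge of the
coboundary and once at each corner marked by chi, and it comes back to its initial
value; hence the two numbers of changes have the same parity. *)
Lemma boundary_coboundary (h chi : {ffun dart E -> bool}) x :
    (forall d, h (phi d) = h d + chi (phi d)) ->
  boundary (coboundary h) x = \sum_(d | origin d == x) chi d.
Proof.
move=> hphi; rewrite boundary_dart; under eq_bigr do rewrite coboundaryE.
have hdrev d : h (drev d) = h (rho d) + chi (rho d).
  by rewrite -phi_drev hphi -addrA addrr_pchar2 // addr0.
have onrho (f : dart E -> bool) :
    \sum_(d | origin d == x) f (rho d) = \sum_(d | origin d == x) f d.
  by rewrite [RHS](reindex_inj (@perm_inj _ rho)); apply: eq_bigl => d;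
    rewrite rho_origin.
under eq_bigr do rewrite hdrev.
by rewrite !big_split /= !onrho addrA addrr_pchar2 // add0r.
Qed.

(** Dimension count.  Sets of faces have dimension F and only the empty set and
the set of all faces have no boundary, so the boundaries have dimension F - 1.
Boundary vertex sets of edge sets include all the even sets of vertices, so the
cycles have dimension at most E - (V - 1), and this is F - 1 by Euler's formula.
Dimensions are expressed by cardinalities, as powers of 2. *)
Lemma cycle_coboundary (p : {ffun edge E -> bool}) (o : dart E) :
    boundary p = 0 ->
  exists2 g : {ffun dart E -> bool}, (forall d, g (phi d) = g d) & p = coboundary g.
Proof.
move=> p0.
pose F := {d : dart E | froots phi d}.
have rootF d : froots phi (froot phi d) by apply/roots_root/fconnect_sym/phi_inj.
pose fc d : F := exist (fun d => froots phi d) (froot phi d) (rootF d).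
pose lift (c : {ffun F -> bool}) : {ffun dart E -> bool} := [ffun d => c (fc d)].
have liftphi c d : lift c (phi d) = lift c d.
  rewrite !ffunE; congr (c _); apply: val_inj => /=; apply/esym/eqP.
  by rewrite root_connect ?fconnect1 //; apply/fconnect_sym/phi_inj.
pose D (c : {ffun F -> bool}) := coboundary (lift c).
have DD c c' : D (c + c') = D c + D c'.
  rewrite /D -coboundaryD; congr coboundary.
  by apply/ffunP => d; rewrite !ffunE.
have cardF : #|{: F}| = fcard phi [pred _ : dart E | true].
  by rewrite card_sig; apply: eq_card => d; rewrite !inE andbT.
have := card_additive DD; rewrite cardF.
set imD := [set D g | g in _]%SET; set kerD := [set g | _]%SET => HF.
have := card_additive (@boundaryD V E); set imB := [set boundary g | g in _]%SET;
  set cyc := [set g | _]%SET.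
have -> : #|{: edge E}| = #|E| by rewrite card_sig; apply: eq_card => e; rewrite !inE.
move=> HE.
have imDcyc : imD \subset cyc.
  apply/fintype.subsetP => _ /imsetP[c _ ->]; rewrite inE; apply/eqP/ffunP => x.
  rewrite (@boundary_coboundary _ 0) => [|d];
    last by rewrite liftphi [X in _ + X]ffunE addr0.
  by rewrite big1 ?ffunE // => d _; rewrite ffunE.
(* A colouring of the faces without boundary is invariant under drev and phi,
   hence under rho, and it is constant because the graph is connected. *)
have kerD2 : (#|kerD| <= 2)%N.
  rewrite -card_bool -(@card_in_imset _ _ (fun c : {ffun F -> bool} => c (fc o)) kerD)
    ?max_card //.
  move=> c c'; rewrite !inE => /eqP c0 /eqP c'0 cc'.
  pose s := lift (c + c').
  have s0 : D (c + c') = 0 by rewrite DD c0 c'0 addr0.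
  have srev d : s (drev d) = s d.
    have := congr1 (fun p : {ffun edge E -> bool} => p (edge_of d)) s0.
    rewrite /= [in RHS]ffunE coboundaryE -/s => /eqP; rewrite -subr_eq0 subr0 -/s.
    by case: (s d); case: (s _).
  have srho d : s (rho d) = s d by rewrite -phi_drev liftphi srev.
  have sorig d d' : origin d = origin d' -> s d = s d'.
    move=> /eqP; have [h _] := hplane; rewrite -h => dd'.
    by apply/eqP; rewrite -(fconnect_invariant (k := s) _ dd') // => z; apply/eqP;
      rewrite srho.
  have sconn x y : connect (adj E) x y ->
      forall d d', origin d = x -> origin d' = y -> s d = s d'.
    move=> /connectP[t et ->] {y}; elim: t x et => [|z t IH] x /= et d d' dx d'y.
      by apply: sorig; rewrite dx d'y.
    case/andP: et => xz et.
    pose dz : dart E := exist (fun p : V * V => [set p.1; p.2]%SET \in E) (x, z) xz.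
    rewrite (sorig d dz) // -srev; exact: IH et _ _ _ d'y.
  have sall d : s d = s o by apply: sconn; [apply: hconn | |].
  apply/ffunP => r; have -> : r = fc (val r).
    by apply: val_inj => /=; apply/esym/eqP; apply: valP r.
  have := sall (val r); rewrite !ffunE cc' => h.
  have {h} : c (fc (val r)) + c' (fc (val r)) = 0 by rewrite h addrr_pchar2.
  by case: (c _); case: (c' _).
(* The vertex sets of even cardinality form a subspace of index at most 2. *)
have imB2 : (2 ^ #|V| <= #|imB| * 2)%N.
  pose tot (f : {ffun V -> bool}) : {ffun unit -> bool} := [ffun _ => \sum_x f x].
  have totD f g : tot (f + g) = tot f + tot g.
    by apply/ffunP => -[]; rewrite !ffunE -big_split /=; apply: eq_bigr => x _;
      rewrite ffunE.
  rewrite (card_additive totD) mulnC leq_mul //; last first.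
    by apply: leq_trans (max_card _) _; rewrite card_ffun card_bool card_unit.
  apply: subset_leq_card; apply/fintype.subsetP => f; rewrite inE => /eqP f0.
  pose O : {ffun edge E -> bool} := [ffun=> true].
  have lO x y : link O x y.
    have := hconn x y; apply: connect_sub => u v uv; apply: connect1; apply/existsP.
    by exists (exist (fun e : {set V} => e \in E) [set u; v]%SET uv);
      rewrite ffunE /= eqxx.
  have [x|q _ <-] := @boundary_onto _ _ hE O f; last exact: imset_f.
  have := congr1 (fun t : {ffun unit -> bool} => t tt) f0; rewrite !ffunE => {2}<-.
  by apply: eq_bigl => y; rewrite lO.
have cycle : imD = cyc.
  apply/eqP; rewrite eqEcard imDcyc /=.
  have [_ euler] := hplane.
  rewrite -(leq_pmul2r (m := 2 ^ #|V| * 2)) ?muln_gt0 ?expn_gt0 //.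
  have cE : (#|cyc| * 2 ^ #|V| <= 2 ^ #|E| * 2)%N by rewrite HE mulnAC (mulnC #|cyc|)
    leq_mul // mulnC.
  have cF : (2 ^ fcard phi [pred _ : dart E | true] <= #|imD| * 2)%N by rewrite HF
    leq_mul.
  apply: (@leq_trans (2 ^ #|E| * 2 * 2)); first by rewrite mulnA leq_mul.
  rewrite -mulnA -(expnD 2 #|E| 2) -euler expnD mulnC mulnA mulnAC leq_mul2r.
  by rewrite cF orbT.
have : p \in cyc by rewrite inE p0.
by rewrite -cycle => /imsetP[c _ ->]; exists (lift c).
Qed.

(** The arc that starts at the corner i1 of a face and stops before the corner i3:
along the face, its indicator only jumps at these two corners.  As i3 is before the
end of the orbit, no other jump occurs when the orbit closes up. *)
Lemma arc_shift (o : dart E) i1 i3 : (i1 < i3 < fingraph.order phi o)%N ->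
  let A : {ffun dart E -> bool} :=
    [ffun d => fconnect phi o d && (i1 <= findex phi o d < i3)%N] in
  let chi : {ffun dart E -> bool} :=
    [ffun d => (d == iter i1 phi o) (+) (d == iter i3 phi o)] in
  forall d, A (phi d) = A d + chi (phi d).
Proof.
move=> /andP[i13 i3N] A chi d.
have addE (u w : bool) : u + w = u (+) w by [].
rewrite /A /chi !ffunE -same_fconnect1_r; last exact: phi_inj.
have [od|nod] := boolP (fconnect phi o d); last first.
  have nphi i : (phi d == iter i phi o) = false.
    apply/eqP => e; move/negP: nod; apply.
    by rewrite same_fconnect1_r ?e ?fconnect_iter //; apply: phi_inj.
  by rewrite !nphi.
have [j jN ->] : exists2 j, (j < fingraph.order phi o)%N & d = iter j phi o.
  by exists (findex phi o d); rewrite ?findex_max // iter_findex.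
have iterE i i' : (i < fingraph.order phi o)%N -> (i' < fingraph.order phi o)%N ->
    (iter i phi o == iter i' phi o) = (i == i').
  move=> iN i'N; apply/eqP/eqP => [e|-> //].
  by rewrite -(findex_iter iN) e findex_iter.
rewrite -iterS /= findex_iter //.
have [jN'|jN'] := ltnP j.+1 (fingraph.order phi o).
  rewrite -iterS findex_iter // !iterE //; last by lia.
  rewrite addE; lia.
have -> : phi (iter j phi o) = iter 0 phi o.
  by rewrite -iterS (_ : j.+1 = fingraph.order phi o) ?iter_order //;
    [apply: phi_inj | lia].
rewrite !iterE ?findex_iter // ?addE; lia.
Qed.

(** Discrete Jordan curve theorem.  Suppose that the cluster of corners 1 and 3
differs from that of corners 2 and 4.  A path p from 1 to 3 and the arc A of the
face from 1 to 3 have the same boundary, so p + coboundary A is the coboundary of a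
colouring g of the faces.  Then h = g + A changes exactly across the edges of p
and, along the face, at the corners 1 and 3.  On the cluster of 2 and 4, which the
path avoids, h is constant; but from 2 to 4 along the face it changes once, at 3. *)
Lemma noncrossing_face (O : {ffun edge E -> bool}) (o : dart E) i1 i2 i3 i4 :
    (i1 < i2 < i3)%N -> (i3 < i4 < fingraph.order phi o)%N ->
    link O (origin (iter i1 phi o)) (origin (iter i3 phi o)) ->
    link O (origin (iter i2 phi o)) (origin (iter i4 phi o)) ->
  link O (origin (iter i1 phi o)) (origin (iter i2 phi o)).
Proof.
move=> /andP[i12 i23] /andP[i34 i4N] l13 l24.
set x1 := origin (iter i1 phi o); set x2 := origin (iter i2 phi o).
case: (boolP (link O x1 x2)) => // nl12.
have [p [_ bp pl]] := link_path hE l13.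
have i13N : (i1 < i3 < fingraph.order phi o)%N by lia.
have := arc_shift i13N; set A := finfun _; set chi := finfun _ => /= Aphi.
have cyc0 : boundary (p + coboundary A) = 0.
  apply/ffunP => x; rewrite boundaryD ffun_boolD bp (boundary_coboundary _ Aphi)
    [RHS]ffunE.
  rewrite ffunE /= addn0 oddD.
  under eq_bigr do rewrite ffunE.
  rewrite big_split /=.
  have one (d0 : dart E) : \sum_(d | origin d == x) (d == d0) = (origin d0 == x).
    rewrite big_mkcond (bigD1 d0) //= big1 ?addr0; first by rewrite eqxx; case: ifP.
    by move=> d /negbTE ->; case: ifP.
  by rewrite !one; case: (_ == x); case: (_ == x).
have [g gphi pg] := cycle_coboundary o cyc0.
pose h := g + A.
have hp d : h d + h (drev d) = p (edge_of d).
  rewrite -coboundaryE coboundaryD -pg; have := ffun_boolDK p (coboundary A).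
  by move=> /(congr1 (fun q : {ffun edge E -> bool} => q (edge_of d))).
have hphi d : h (phi d) = h d + chi (phi d).
  by rewrite !ffun_boolD gphi Aphi; apply: addbA.
have chi0 d : ~~ link O x1 (origin d) -> chi d = false.
  move=> nd; rewrite ffunE; case: eqP => [e|_]; first by rewrite e link_refl in nd.
  by case: eqP => [e|_] //; rewrite e l13 in nd.
have hrho d : ~~ link O x1 (origin d) -> h (rho d) = h d.
  move=> nd; rewrite -phi_drev hphi chi0 ?phi_drev ?rho_origin // addr0.
  have : p (edge_of d) = false.
    apply: contraNF nd => pe; apply: pl pe _.
    by rewrite val_edge_of !inE eqxx.
  by rewrite -hp; case: (h d); case: (h _).
have hfan d d' : origin d = origin d' -> ~~ link O x1 (origin d) -> h d = h d'.
  move=> dd' nd; have : fconnect rho d d' by have [-> _] := hplane; rewrite dd'.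
  case/connectP => s + -> {d' dd'}; elim: s d nd => [|d' s IH] d nd //= /andP[/eqP <- es].
  by rewrite -(hrho d nd) IH ?rho_origin.
have hlink x y : link O x y -> ~~ link O x1 x ->
    forall d d', origin d = x -> origin d' = y -> h d = h d'.
  move=> /connectP[t et ->] {y}; elim: t x et => [|z t IH] x /= et nx d d' dx d'y.
    by apply: hfan; rewrite dx.
  case/andP: et => /existsP[e /andP[/eqP eE Oe]] et.
  have xzE : [set x; z]%SET \in E by rewrite -eE; apply: valP.
  pose dz : dart E := exist (fun p : V * V => [set p.1; p.2]%SET \in E) (x, z) xzE.
  have lxz : link O x z by apply: link_edge Oe eE.
  have nz : ~~ link O x1 z.
    by apply: contraNN nx => l1z; apply: link_trans l1z _; rewrite link_sym.
  have oz : origin (phi dz) = z by rewrite phi_origin.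
  rewrite (hfan d dz) ?dx // -(IH _ et nz (phi dz) d' oz d'y).
  by rewrite hphi chi0 ?addr0 // oz.
have h24 : h (iter i2 phi o) = h (iter i4 phi o) by apply: hlink l24 nl12 _ _ erefl erefl.
have gi i : g (iter i phi o) = g o by elim: i => //= i IH; rewrite gphi.
move: h24; rewrite !ffun_boolD !gi !ffunE !fconnect_iter !findex_iter; lia.
Qed.

Lemma noncrossing_ccw (O : {ffun edge E -> bool}) (o : dart E) (S : {set V}) s :
  ccw_order rho o S s -> noncrossing (link O) s.
Proof.
move=> [_ _ [d _ sub]]; apply: noncrossing_sub sub _ => x y z w.
have step x0 (u : V) (t t' : seq V) : subseq (u :: t) t' ->
    exists i, [/\ (i < size t')%N, nth x0 t' i = u & subseq t (drop i.+1 t')].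
  elim: t' => //= v t' IH; case: eqP => [<- h|_ /IH[i [? ? ?]]].
    by exists 0%N; rewrite /= drop0.
  by exists i.+1.
have sz := fingraph.size_orbit phi d; set orb := [seq origin e | e <- _].
have so : size orb = fingraph.order phi d by rewrite size_map sz.
have orbE i : (i < fingraph.order phi d)%N -> nth x orb i = origin (iter i phi d).
  by move=> iN; rewrite (nth_map d) ?sz // nth_traject.
move=> /(step x)[i1 [l1 <- /(step x)[i2 [l2 <- /(step x)[i3 [l3 <- /(step x)[i4 [l4 <-
  _]]]]]]]].
move: l1 l2 l3 l4; rewrite !nth_drop !size_drop so => l1 l2 l3 l4.
rewrite !orbE; try lia.
by apply: noncrossing_face; lia.
Qed.

End Planarity.

(** * The parity model and the switching lemma *)

Section ParityModel.
Variables (R : comNzRingType) (V : finType) (E : {set {set V}}).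
Hypothesis hE : simple_graph E.
Variables (c s : edge E -> R).
Hypothesis cs1 : forall e, c e ^+ 2 = s e ^+ 2 + 1.
Implicit Types (p q u O : {ffun edge E -> bool}) (f g : {ffun V -> bool}) (t : seq V).

(** With c = cosh J and s = sinh J this is the total weight of the currents that
are odd exactly on p. *)
Definition parity_weight p : R := \prod_e (if p e then s e else c e).

Definition parity_Z f : R := \sum_(p | boundary p == f) parity_weight p.

(** With c = cosh J and s = sinh J this is the total weight at e of the pairs of
values with parities b1 and b2 whose sum is nonzero if and only if o holds.  For
even values that are not both zero it is c^2 - 1 = s^2, as for two odd values; so
on O the weight depends on b1 + b2 only, which is what switching needs. *)
Definition pair_factor (e : edge E) (b1 b2 o : bool) : R :=
  if o then (if b1 (+) b2 then s e * c e else s e ^+ 2)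
  else (if b1 || b2 then 0 else 1).

Definition pair_weight p q O : R := \prod_e pair_factor e (p e) (q e) (O e).

Definition pair_Z f g O : R :=
  \sum_(p | boundary p == f) \sum_(q | boundary q == g) pair_weight p q O.

Lemma parity_Z_mul f g : parity_Z f * parity_Z g = \sum_O pair_Z f g O.
Proof.
rewrite /parity_Z /pair_Z mulr_suml exchange_big /=; apply: eq_bigr => p _.
rewrite mulr_sumr exchange_big /=; apply: eq_bigr => q _.
rewrite /pair_weight -(bigA_distr_bigA (fun e o => pair_factor e (p e) (q e) o)) /=.
rewrite -big_split /=; apply: eq_bigr => e _; rewrite big_bool /pair_factor.
by case: (p e); case: (q e) => /=; rewrite ?addr0 -?expr2 ?cs1 // mulrC.
Qed.

Lemma pair_weight_inside p q O :
  ~~ (inside p O && inside q O) -> pair_weight p q O = 0.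
Proof.
have zero e : ~~ O e -> p e || q e -> pair_weight p q O = 0.
  by move=> /negbTE Oe pq; rewrite /pair_weight (bigD1 e) //= Oe /pair_factor pq mul0r.
rewrite negb_and => /orP[] /forallPn[e]; rewrite negb_imply => /andP[pe Oe];
  by apply: (zero e); rewrite ?pe ?orbT.
Qed.

Lemma pair_weight_shift p q u O : inside u O ->
  pair_weight (p + u) (q + u) O = pair_weight p q O.
Proof.
move=> /forallP uO; apply: eq_bigr => e _; rewrite !ffun_boolD /pair_factor.
have := uO e; case: (O e) => /=; last by case: (u e); rewrite ?addbF.
by rewrite addbACA addbb addbF.
Qed.

Lemma boundary_parity_even p O t :
  inside p O -> boundary p = parity t -> even_classes (link O) t.
Proof.
move=> pO bp; apply/(even_classesP (@link_sym _ _ O) (@link_trans _ _ O)) => x.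
by rewrite -parity_sum -bp (boundary_even hE).
Qed.

Lemma pair_Z_eq0 t g O :
  ~~ even_classes (link O) t -> pair_Z (parity t) g O = 0.
Proof.
move=> nt; apply: big1 => p /eqP bp; apply: big1 => q _; apply: pair_weight_inside.
by apply: contra nt => /andP[pO _]; apply: boundary_parity_even pO bp.
Qed.

(** Switching lemma: the weights do not change when an edge set u of O with
boundary t is added to both currents, and such a u exists exactly when t is even
in every cluster of O. *)
Lemma pair_Z_switch f t O :
  pair_Z f (parity t) O = (even_classes (link O) t)%:R * pair_Z (f + parity t) 0 O.
Proof.
have [et|nt] := boolP (even_classes _ _); last first.
  rewrite mul0r; apply: big1 => p _; apply: big1 => q /eqP bq; apply: pair_weight_inside.
  by apply: contra nt => /andP[_ qO]; apply: boundary_parity_even qO bq.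
rewrite mul1r; have [x|u uO bu] := boundary_onto hE (O := O) (f := parity t).
  by rewrite parity_sum; apply/negbTE;
    move/(even_classesP (@link_sym _ _ O) (@link_trans _ _ O)): et.
have bd (p : {ffun edge E -> bool}) h : (boundary (p + u) == h) = (boundary p == h +
  parity t).
  rewrite boundaryD bu; apply/eqP/eqP => [<-|->]; by rewrite ffun_boolDK.
rewrite [RHS](reindex_inj (addIr u)) /=; apply: eq_big => [p|p _].
  by rewrite bd ffun_boolDK.
rewrite [RHS](reindex_inj (addIr u)) /=; apply: eq_big => [q|q _].
  by rewrite bd add0r.
by rewrite pair_weight_shift.
Qed.

End ParityModel.

(** * Pfaffians of kernels with a sign *)

Section SignedPfaffian.
Variables (R : comNzRingType) (T : eqType) (n : nat) (a b : n.-tuple T).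
Hypothesis ab : forall x, x \in b -> x \notin a.

Definition side (x : T) : R := if x \in a then 1 else -1.

(** This kernel is 0 inside a and outside a, and 2 K across.  It is written as a
sum of two kernels that differ by a sign factor in each variable, so that its
Pfaffian is a shuffle sum of products of Pfaffians of K. *)
Definition cross_kernel (K : T -> T -> R) (y z : T) : R :=
  K y z + -1 * (side y * side z) * K y z.

Lemma pf_cross_kernel (x0 : T) (K : T -> T -> R) :
  pf (cross_kernel K) (a ++ rev b) =
  2 ^+ n * \det (\matrix_(i < n, j < n) K (tnth a i) (tnth b j)).
Proof.
rewrite (@pf_det _ _ _ x0 n) ?size_tuple //.
  rewrite -detZ; congr (\det _); apply/matrixP => i j; rewrite !mxE -!tnth_nth.
  rewrite /cross_kernel /side mem_tnth (negbTE (ab _)) ?mem_tnth //; ring.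
by move=> y z ya za; rewrite /cross_kernel /side ya za; ring.
Qed.

End SignedPfaffian.

(** * Correlations of boundary vertices *)

Section BoundaryCorrelations.
Variables (R : numFieldType) (V : finType) (E : {set {set V}}).
Hypothesis hE : simple_graph E.
Variables (c s : edge E -> R).
Hypothesis cs1 : forall e, c e ^+ 2 = s e ^+ 2 + 1.

Implicit Types (O : {ffun edge E -> bool}) (t u w : seq V).

Definition source_Z t : R := parity_Z c s (parity t).
Definition source_pair_Z t O : R := pair_Z c s (parity t) 0 O.

Local Notation Z := source_Z.
Local Notation mu := source_pair_Z.

Hypothesis Z0 : Z [::] != 0.

Definition corr (x y : V) : R := Z [:: x; y] / Z [::].

Lemma Z_mul t u w : perm_eq (t ++ u) w ->
  Z t * Z u = \sum_O (even_classes (link O) u)%:R * mu w O.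
Proof.
move=> tuw; rewrite /source_Z (parity_Z_mul cs1); apply: eq_bigr => O _.
by rewrite (pair_Z_switch hE) -parity_cat (parity_perm tuw).
Qed.

Lemma even_classes2 O x y : even_classes (link O) [:: x; y] = link O x y.
Proof.
rewrite /even_classes /= !link_refl (link_sym O y x) /=.
by case: (link O x y).
Qed.

(** Expanding along the first source x, the product of the correlation of x and y
with that of the remaining sources is the sum of the pair weights over the O in
which x and y are connected; for each O these terms, with their alternating signs, add
up to 1. *)
Lemma Z_pf t :
  (forall O, noncrossing (link O) t) -> Z t = Z [::] * pf corr t.
Proof.
have [n] := ubnP (size t); elim: n t => // n IH [|x t] /= tn nc; first by rewrite mulr1.
apply: (mulfI Z0); rewrite pf_cons (contractionE _ _ _ x) [in RHS]mulr_sumr [in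
  RHS]mulr_sumr.
transitivity (\sum_(j < size t) (-1) ^+ j *
    \sum_O (link O x (nth x t j))%:R * mu (x :: t) O); last first.
  apply: eq_bigr => j _; rewrite -!mulrA !(mulrCA _ ((-1) ^+ j)); congr (_ * _).
  under eq_bigr do rewrite -even_classes2.
  rewrite -(@Z_mul (del j t)); last first.
    by rewrite perm_catC /= perm_cons perm_del.
  rewrite IH; first by rewrite /corr; field.
    by have := size_del (ltn_ord j); lia.
  move=> O; apply: noncrossing_sub (nc O); apply: subseq_trans (subseq_cons _ _).
  exact: subseq_del.
under eq_bigr do rewrite mulr_sumr.
rewrite exchange_big /= mulrC (@Z_mul _ _ (x :: t)) ?cats0 //; apply: eq_bigr => O _.
have [/(even_classesP (@link_sym _ _ O) (@link_trans _ _ O)) ev|nev] := boolP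
  (even_classes (link O) (x :: t)); last first.
  by rewrite /source_pair_Z (pair_Z_eq0 hE) // mulr0 big1 // => j _; rewrite !mulr0.
have alt := @contraction_class _ _ (@link_refl _ _ O) (@link_sym _ _ O) (@link_trans _ _
  O) R x t (nc O).
have {}alt : contraction (@link_kernel V (link O) R) x (fun=> 1) t = 1.
  rewrite alt; first by have := ev x; rewrite /= link_refl /= negbK => ->.
  by move=> z xz; have := ev z; rewrite /= link_sym (negbTE xz).
under eq_bigr do rewrite mulrA.
rewrite -mulr_suml; congr (_ * _); rewrite /= -[LHS]alt (contractionE _ _ _ x).
by apply: eq_bigr => j _; rewrite mulr1.
Qed.

(** If w is even in every cluster then t and u are so simultaneously; this allows
to replace the indicator of one of these events by the product of both, that is, of
two Pfaffians of the 0-1 kernel. *)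
Lemma Z_pf_pair t u w :
    (forall O, noncrossing (link O) w) ->
    subseq t w -> subseq u w -> perm_eq (t ++ u) w ->
  Z [::] ^+ 2 * (pf corr t * pf corr u) =
  \sum_O mu w O * (pf (@link_kernel V (link O) R) t * pf (@link_kernel V (link O) R) u).
Proof.
move=> nc tw uw tuw.
have -> : Z [::] ^+ 2 * (pf corr t * pf corr u) = Z t * Z u.
  have ncs v : subseq v w -> Z v = Z [::] * pf corr v.
    by move=> vw; apply: Z_pf => O; apply: noncrossing_sub (nc O).
  by rewrite (ncs t) // (ncs u) //; ring.
rewrite (Z_mul tuw); apply: eq_bigr => O _.
have [ew|nev] := boolP (even_classes (link O) w); last first.
  by rewrite /source_pair_Z (pair_Z_eq0 hE) // mulr0 mul0r.
have eqv := (@link_sym _ _ O, @link_trans _ _ O).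
rewrite !(pf_link (@link_refl _ _ O) eqv.1 eqv.2); last first.
- exact: noncrossing_sub (nc O).
- exact: noncrossing_sub (nc O).
rewrite mulrC -natrM mulnb; congr (_ * _%:R); congr nat_of_bool.
apply/esym/andb_idl => /(even_classesP eqv.1 eqv.2) eu.
apply/(even_classesP eqv.1 eqv.2) => x.
have /(even_classesP eqv.1 eqv.2)/(_ x) := ew.
by rewrite -(seq.permP tuw) count_cat oddD (negbTE (eu x)) addbF.
Qed.

(** Both sides are the same linear combination, over the splittings (t, u) of w,
of products of two Pfaffians, since the coefficients do not involve the kernel. *)
Lemma pf_cross_corr n (a : n.-tuple V) w :
    (forall O, noncrossing (link O) w) ->
  Z [::] ^+ 2 * pf (cross_kernel a corr) w =
  \sum_O mu w O * pf (cross_kernel a (@link_kernel V (link O) R)) w.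
Proof.
move=> nc; pose coef (u : seq V) : R := (-1) ^+ (size u)./2 * \prod_(y <- u) side R a y.
have crossE K : pf (cross_kernel a K) w = shuffle (fun t u => coef u * (pf K t * pf K u))
  w.
  rewrite pfD; apply: eq_shuffle_ext => t u.
  by rewrite pf_scale /coef; ring.
rewrite crossE -shuffleZ; under eq_bigr do rewrite crossE -shuffleZ.
rewrite -shuffle_sum; apply: eq_shuffle => t u tw uw tuw.
rewrite mulrCA (Z_pf_pair nc tw uw tuw) mulr_sumr.
by apply: eq_bigr => O _; rewrite mulrCA.
Qed.

Lemma det_corr (x0 : V) n (a b : n.-tuple V) :
    (forall x, x \in b -> x \notin a) ->
    (forall O, noncrossing (link O) (a ++ rev b)) ->
  Z [::] ^+ 2 * \det (\matrix_(i < n, j < n) corr (tnth a i) (tnth b j)) =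
  \sum_O mu (a ++ rev b) O * (parallel_classes (link O) (tnth a) (tnth b))%:R.
Proof.
move=> ab nc; have two : (2 ^+ n : R) != 0 by rewrite expf_neq0 ?pnatr_eq0.
apply: (mulfI two); rewrite mulrCA -(pf_cross_kernel ab x0) pf_cross_corr //.
rewrite mulr_sumr; apply: eq_bigr => O _; rewrite (pf_cross_kernel ab x0) mulrCA;
  congr (_ * _).
have [ew|nev] := boolP (even_classes (link O) (a ++ rev b)); last first.
  by rewrite /source_pair_Z (pair_Z_eq0 hE) // !mul0r.
congr (_ * _); have codomT (v : n.-tuple V) : codom (tnth v) = v.
  by rewrite codomE map_tnth_enum.
rewrite -(det_parallel_classes (@link_refl _ _ O) (@link_sym _ _ O) (@link_trans _ _ O)
  R) ?codomT //.
Qed.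

End BoundaryCorrelations.

(** * High temperature expansion of the Ising model *)

Section HighTemperature.
Variables (R : realType) (V : finType) (E : {set {set V}}) (J : edge E -> R).

Definition cosh_coupling (e : edge E) : R := (expR (J e) + expR (- J e)) / 2.

Definition sinh_coupling (e : edge E) : R := (expR (J e) - expR (- J e)) / 2.

Lemma cosh_sinh e : cosh_coupling e ^+ 2 = sinh_coupling e ^+ 2 + 1.
Proof.
have h : expR (J e) * expR (- J e) = 1 by rewrite expRxMexpNx_1.
by rewrite -[X in _ = _ + X]h /cosh_coupling /sinh_coupling; field.
Qed.

Lemma expR_sign e (b : bool) :
  expR (J e * (-1) ^+ b) = cosh_coupling e + sinh_coupling e * (-1) ^+ b.
Proof.
by rewrite /cosh_coupling /sinh_coupling; case: b;
  rewrite ?expr1 ?expr0 ?mulrN1 ?mulr1; field.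
Qed.

Lemma sum_spin (m : V -> nat) :
  \sum_(s : {ffun V -> bool}) \prod_x spin R s x ^+ m x =
  if [forall x, ~~ odd (m x)] then 2 ^+ #|V| else 0.
Proof.
rewrite /spin -(bigA_distr_bigA (fun x (b : bool) => ((-1) ^+ b) ^+ m x : R)) /=.
case: ifP => [/forallP ev|/negbT /forallPn[x]].
  rewrite -prodr_const; apply: eq_bigr => x _.
  by rewrite big_bool expr1 expr1n -signr_odd (negbTE (ev x)).
rewrite negbK => od; rewrite (bigD1 x) //= big_bool expr1 expr1n -signr_odd od.
by rewrite expr1 /= addNr mul0r.
Qed.

Lemma prod_spin_sign (s : {ffun V -> bool}) (A : {set V}) :
  exists b : bool, \prod_(x in A) spin R s x = (-1) ^+ b.
Proof.
apply: (big_ind (fun y => exists b : bool, y = (-1) ^+ b)).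
- by exists false.
- by move=> _ _ [b ->] [b' ->]; exists (b (+) b'); rewrite signr_addb.
by move=> x _; exists (s x).
Qed.

(** Each factor exp (J sigma_x sigma_y) is cosh J + sigma_x sigma_y sinh J.  After
expanding the product over the edges, the sum over the spins kills every edge set
whose boundary is not t. *)
Lemma high_temperature (t : seq V) :
  \sum_(s : {ffun V -> bool}) ising_weight J s * \prod_(x <- t) spin R s x =
  2 ^+ #|V| * parity_Z cosh_coupling sinh_coupling (parity t).
Proof.
have expand s : ising_weight J s = \sum_(p : {ffun edge E -> bool})
    parity_weight cosh_coupling sinh_coupling p *
    \prod_x spin R s x ^+ (\sum_(e : edge E | x \in val e) p e)%N.
  pose F (e : edge E) (b : bool) := (if b then sinh_coupling e else cosh_coupling e) *
    (if b then \prod_(x in val e) spin R s x else 1).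
  transitivity (\prod_e \sum_(b : bool) F e b).
    apply: eq_bigr => e _; rewrite big_bool /F /= mulr1 addrC.
    by have [b ->] := prod_spin_sign s (val e); apply: expR_sign.
  rewrite bigA_distr_bigA; apply: eq_bigr => p _; rewrite /F big_split /=; congr (_ * _).
  transitivity (\prod_(e : edge E) \prod_(x | x \in val e) spin R s x ^+ p e).
    by apply: eq_bigr => e _; case: (p e);
      [under [RHS]eq_bigr do rewrite expr1 | rewrite big1].
  rewrite [RHS](eq_bigr (fun x => \prod_(e : edge E | x \in val e) spin R s x ^+ p e)).
    by rewrite (exchange_big_dep predT).
  by move=> x _; rewrite -prodrXr.
under eq_bigr do rewrite expand mulr_suml.
rewrite exchange_big /= /parity_Z [in RHS]big_mkcond [in RHS]mulr_sumr;
  apply: eq_bigr => p _.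
have count s : \prod_(x <- t) spin R s x = \prod_x spin R s x ^+ count_mem x t.
  elim: t => [|y t IH]; first by rewrite big_nil big1.
  rewrite big_cons IH [RHS](eq_bigr (fun x => spin R s x ^+ (y == x) * spin R s x ^+
    count_mem x t)).
    rewrite big_split /=; congr (_ * _); rewrite (bigD1 y) //= eqxx big1 ?mulr1 // => x.
    by rewrite eq_sym => /negbTE ->.
  by move=> x _; rewrite -exprD.
under eq_bigr do rewrite count -mulrA -big_split /=.
rewrite -mulr_sumr.
under eq_bigr do under eq_bigr do rewrite -exprD.
rewrite sum_spin; set ev := FiniteQuant.quant0b _.
suff -> : ev = (boundary p == parity t) by case: eqP; rewrite ?mulr0 // mulrC.
rewrite {}/ev; apply/forallP/eqP => [ev|bp x].
  apply/ffunP => x; have := ev x; rewrite oddD !ffunE.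
  rewrite (big_morph odd oddD erefl) /=.
  by under eq_bigr do rewrite oddb; case: (\sum_(_ | _) _); case: (odd _).
rewrite oddD (big_morph odd oddD erefl) /=; under eq_bigr do rewrite oddb.
have := congr1 (fun f : {ffun V -> bool} => f x) bp; rewrite !ffunE => ->.
by rewrite addbb.
Qed.

Lemma ising_corrE (x y : V) :
  ising_corr J x y =
  parity_Z cosh_coupling sinh_coupling (parity [:: x; y]) /
  parity_Z cosh_coupling sinh_coupling (parity [::]).
Proof.
have h0 : ising_Z J = 2 ^+ #|V| * parity_Z cosh_coupling sinh_coupling (parity [::]).
  by rewrite -high_temperature; apply: eq_bigr => s _; rewrite big_nil mulr1.
have two : (2 ^+ #|V| : R) != 0 by rewrite expf_neq0 ?pnatr_eq0.
rewrite /ising_corr /ising_prob h0.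
transitivity ((\sum_s ising_weight J s * \prod_(z <- [:: x; y]) spin R s z) /
  (2 ^+ #|V| * parity_Z cosh_coupling sinh_coupling (parity [::]))).
  rewrite mulr_suml; apply: eq_bigr => s _.
  by rewrite !big_cons big_nil mulr1 mulrAC.
by rewrite high_temperature invfM mulrACA divff // mul1r.
Qed.

Lemma parity_Z0 : parity_Z cosh_coupling sinh_coupling (parity [::]) != 0.
Proof.
have two : (2 ^+ #|V| : R) != 0 by rewrite expf_neq0 ?pnatr_eq0.
suff : 2 ^+ #|V| * parity_Z cosh_coupling sinh_coupling (parity [::]) != 0.
  by rewrite mulf_eq0 negb_or => /andP[].
rewrite -high_temperature; apply: lt0r_neq0.
under eq_bigr do rewrite big_nil mulr1.
have w0 s : 0 < ising_weight J s by apply: prodr_gt0 => e _; apply: expR_gt0.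
rewrite (bigD1 [ffun=> false]) //=; apply: ltr_pwDl => //.
by apply: sumr_ge0 => s _; apply: ltW.
Qed.

End HighTemperature.

(** * Sums of nonnegative families *)

Section RealSums.
Variable (R : realType).
Local Open Scope classical_set_scope.

Lemma ge0_esum_le_scale (T : choiceType) (S : set T) (k : R) (f : T -> R) :
    0 <= k -> (forall t, 0 <= f t) ->
  (\esum_(t in S) (k * f t)%:E <= k%:E * \esum_(t in S) (f t)%:E)%E.
Proof.
move=> k0 f0; apply: ge_ereal_sup => _ [F SF <-].
under eq_fsbigr do rewrite EFinM.
rewrite -ge0_mule_fsumr; last by move=> t; rewrite lee_fin.
by apply: lee_pmul => //; [rewrite fsume_ge0 // => t _;
  rewrite lee_fin | apply: esum_ge; exists F].
Qed.

(** The inequality above, applied with k and with its inverse. *)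
Lemma esum_scale (T : choiceType) (S : set T) (k v : R) (f : T -> R) :
    0 <= k -> (forall t, 0 <= f t) ->
    \esum_(t in S) (f t)%:E = v%:E ->
  \esum_(t in S) (k * f t)%:E = (k * v)%:E.
Proof.
move=> k0 f0 fv; have [->|kn0] := eqVneq k 0.
  by rewrite mul0r esum1 // => t _; rewrite mul0r.
have kp : 0 < k by rewrite lt_def kn0.
have := ge0_esum_le_scale S k0 f0; rewrite fv -EFinM => le1.
have kf0 t : 0 <= k * f t by rewrite mulr_ge0.
have ki0 : 0 <= k^-1 by rewrite invr_ge0.
have := ge0_esum_le_scale S ki0 kf0.
under eq_esum do rewrite mulKf //.
rewrite fv; have : (0 <= \esum_(t in S) (k * f t)%:E)%E by apply: esum_ge0 => t _;
  rewrite lee_fin.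
case: (\esum_(t in S) (k * f t)%:E) le1 => [w| |] //; rewrite !lee_fin => le1 _ le2.
congr (_%:E); apply/eqP; rewrite eq_le le1 /=.
by rewrite mulrC -ler_pdivlMr // mulrC.
Qed.

Lemma esum_classes (U : choiceType) (C : finType) (kappa : U -> C) (G : pred C)
    (w : U -> R) (W : C -> R) :
    (forall u, 0 <= w u) ->
    (forall g, \esum_(u in [set u | kappa u = g]) (w u)%:E = (W g)%:E) ->
  \esum_(u in [set u | G (kappa u)]) (w u)%:E = (\sum_(g | G g) W g)%:E.
Proof.
move=> w0 HW; rewrite -sumEFin; under eq_bigr do rewrite -HW esum_mkcond.
rewrite -esum_sum; last by move=> u g _ _; case: ifP => // _; rewrite lee_fin.
rewrite esum_mkcond; apply: eq_esum => u _; case: ifPn => [|nG].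
  rewrite inE /= => Gu; rewrite (bigD1 (kappa u)) //= mem_set // big1 ?adde0 // => g
    /andP[_ gu].
  by rewrite memNset // => /= ku; rewrite ku eqxx in gu.
rewrite big1 // => g Gg; rewrite memNset // => /= ku; case/negP: nG.
by rewrite inE /= ku.
Qed.

Lemma esum_product (T1 T2 : choiceType) (A1 : set T1) (A2 : set T2)
    (f1 : T1 -> R) (f2 : T2 -> R) v1 v2 :
    (forall t, 0 <= f1 t) -> (forall t, 0 <= f2 t) ->
    \esum_(t in A1) (f1 t)%:E = v1%:E -> \esum_(t in A2) (f2 t)%:E = v2%:E ->
  \esum_(p in [set p | A1 p.1 /\ A2 p.2]) (f1 p.1 * f2 p.2)%:E = (v1 * v2)%:E.
Proof.
move=> f10 f20 fv1 fv2.
have -> : [set p : T1 * T2 | A1 p.1 /\ A2 p.2] = A1 `*`` (fun=> A2) by [].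
rewrite -(@esum_esum _ _ _ A1 (fun=> A2) (fun x y => (f1 x * f2 y)%:E)); last first.
  by move=> x y _ _; rewrite lee_fin mulr_ge0.
under eq_esum => x _ do rewrite (esum_scale (f10 x) f20 fv2) mulrC.
rewrite (esum_scale _ f10 fv1) 1?mulrC //.
rewrite -lee_fin -fv2; apply: esum_ge0 => t _; by rewrite lee_fin.
Qed.

(** The sum of a product over a product of index sets is the product of the sums.
By induction on the indices that are free to vary, the other ones being fixed
at t0. *)
Lemma esum_prod_ffun (I : finType) (T : choiceType) (t0 : T) (A : I -> set T)
    (f : I -> T -> R) (v : I -> R) :
    (forall i t, 0 <= f i t) ->
    (forall i, \esum_(t in A i) (f i t)%:E = (v i)%:E) ->
  \esum_(n in [set n : {ffun I -> T} | forall i, A i (n i)]) (\prod_i f i (n i))%:E =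
    (\prod_i v i)%:E.
Proof.
move=> f0 fv.
pose S (r : seq I) := [set n : {ffun I -> T} | forall i, if i \in r then A i (n i) else n
  i = t0].
suff H r : uniq r -> \esum_(n in S r) (\prod_(i <- r) f i (n i))%:E = (\prod_(i <- r) v
  i)%:E.
  have := H (index_enum I) (index_enum_uniq I); congr (_ = _); congr esum.
  by apply/seteqP; split => n nA i; have := nA i; rewrite mem_index_enum.
elim: r => [_|x r IH /andP[xr ur]].
  have -> : S [::] = [set [ffun=> t0]].
    apply/seteqP; split => [n nS|n -> i] /=; last by rewrite ffunE.
    by apply/ffunP => i; rewrite ffunE; have := nS i.
  by rewrite big_nil esum_set1 ?big_nil // lee_fin.
pose e (p : T * {ffun I -> T}) : {ffun I -> T} := [ffun i => if i == x then p.1 else p.2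
  i].
rewrite (@reindex_esum _ _ _ [set p | A x p.1 /\ S r p.2] (S (x :: r)) e).
  rewrite big_cons -(esum_product (f0 x) _ (fv x) (IH ur)); last first.
    by move=> n; apply: prodr_ge0 => i _; apply: f0.
  apply: eq_esum => -[t n] _ /=; rewrite big_cons /e ffunE eqxx; congr (_ * _)%:E.
  rewrite !(big_seq_cond xpredT); apply: eq_bigr => i /andP[ir _].
  by rewrite ffunE; case: eqP ir xr => [->|//] ->.
split.
- move=> [t n] [/= At nS] i; rewrite inE ffunE; case: eqP => [->|_] //=.
  exact: nS.
- move=> [t n] [t' n']; rewrite !inE => -[/= _ nS] [/= _ nS'] en.
  have tt : t = t' by have := congr1 (fun g : {ffun I -> T} => g x) en;
    rewrite !ffunE eqxx.
  congr pair => //; apply/ffunP => i.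
  have := congr1 (fun g : {ffun I -> T} => g i) en; rewrite !ffunE;
    case: eqP => [->|//] _.
  by have := nS x; have := nS' x; rewrite (negbTE xr) => -> ->.
move=> n nS; exists (n x, [ffun i => if i == x then t0 else n i]).
  split => /=; first by have := nS x; rewrite mem_head.
  move=> i; rewrite ffunE; have := nS i; rewrite inE; case: eqP => [->|_] //=.
  by rewrite (negbTE xr).
by apply/ffunP => i; rewrite !ffunE /=; case: eqP => [->|].
Qed.

(** The even and odd parts of the exponential series are the half sum and the
half difference of the series at x and at - x. *)
Lemma esum_exp_parity (x : R) (b : bool) : 0 <= x ->
  \esum_(n in [set n : nat | odd n = b]) (x ^+ n / n`!%:R)%:E =
  ((expR x + (-1) ^+ b * expR (- x)) / 2)%:E.
Proof.
move=> x0.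
have t0 n : 0 <= x ^+ n / n`!%:R by rewrite divr_ge0 ?exprn_ge0.
have -> : [set n : nat | odd n = b] = [set n : nat | odd n == b].
  by apply/seteqP; split => n /=; [move=> -> | move/eqP].
rewrite -(@nneseries_esum _ _ (fun n => odd n == b)); last by move=> n _; rewrite lee_fin.
apply: cvg_lim => //.
under eq_fun do rewrite sumEFin.
apply: cvg_EFin; first exact: nearW.
rewrite [X in X @ _](_ : _ = (fun n => (series (exp_coeff x) n + (-1) ^+ b * series
  (exp_coeff (- x)) n) / 2)).
  apply: cvgM; last exact: cvg_cst.
  apply: cvgD; first exact: is_cvg_series_exp_coeff.
  by apply: cvgM; [exact: cvg_cst | exact: is_cvg_series_exp_coeff].
apply/funext => n /=; rewrite /series /= mulr_sumr -big_split /= mulr_suml big_mkcond /=.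
apply: eq_bigr => m _; rewrite /exp_coeff /= (exprNn x).
rewrite -(signr_odd _ m); case: (odd m); case: b => /=; rewrite ?expr0 ?expr1; field;
by rewrite pnatr_eq0 -lt0n fact_gt0.
Qed.

End RealSums.

(** * From currents to the parity model *)

Section CurrentsParity.
Variables (R : realType) (V : finType) (E : {set {set V}}) (J : edge E -> R).
Hypothesis J0 : forall e, 0 <= J e.
Local Open Scope classical_set_scope.

Local Notation c := (cosh_coupling J).
Local Notation s := (sinh_coupling J).

Definition current_parity (n : current E) : {ffun edge E -> bool} := [ffun e => odd (n
  e)].

Definition support_add (n1 n2 : current E) : {ffun edge E -> bool} :=
  [ffun e => (n1 e + n2 e != 0)%N].

Definition mark (S : {set V}) : {ffun V -> bool} := [ffun x => x \in S].

Lemma sourcesE (n : current E) (S : {set V}) :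
  (sources n == S) = (boundary (current_parity n) == mark S).
Proof.
have bE x : boundary (current_parity n) x = (x \in sources n).
  rewrite inE ffunE (big_morph odd oddD erefl); apply: eq_bigr => e _.
  by rewrite ffunE.
apply/eqP/eqP => [<-|bS]; first by apply/ffunP => x; rewrite bE ffunE.
by apply/setP => x; rewrite -bE bS ffunE.
Qed.

Let coef (e : edge E) (m : nat) : R := J e ^+ m / m`!%:R.

Lemma coef_ge0 e m : 0 <= coef e m.
Proof. by rewrite divr_ge0 ?exprn_ge0. Qed.

Lemma curr_weight_ge0 n : 0 <= curr_weight J n.
Proof. by apply: prodr_ge0 => e _; apply: coef_ge0. Qed.

Lemma esum_coef e (b : bool) :
  \esum_(m in [set m : nat | odd m = b]) (coef e m)%:E = (if b then s e else c e)%:E.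
Proof.
rewrite esum_exp_parity //; congr (_%:E).
by case: b; rewrite /cosh_coupling /sinh_coupling ?expr1 ?expr0 ?mulN1r ?mul1r.
Qed.

Lemma curr_ZE (S : {set V}) : curr_Z J S = (parity_Z c s (mark S))%:E.
Proof.
rewrite /curr_Z.
rewrite -(@esum_classes _ _ _ current_parity (fun p => boundary p == mark S)
  (curr_weight J) (parity_weight c s)).
- congr esum; apply/seteqP; split => n /=; first by move=> /eqP; rewrite sourcesE.
  by rewrite -sourcesE => /eqP.
- exact: curr_weight_ge0.
move=> p; rewrite /parity_weight.
rewrite -(@esum_prod_ffun _ _ _ 0%N (fun e => [set m | odd m = p e]) coef).
- congr esum; apply/seteqP; split => n /= np.
    by move=> e; rewrite -np ffunE.
  by apply/ffunP => e; rewrite ffunE np.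
- exact: coef_ge0.
by move=> e; apply: esum_coef.
Qed.

(** Fixing the parities decouples the two values.  Whether their sum is nonzero
matters only if both are even, and then the pair (0, 0) has to be set apart. *)
Lemma esum_pair_factor e (b1 b2 o : bool) :
  \esum_(m in [set m : nat * nat |
      odd m.1 = b1 /\ odd m.2 = b2 /\ (m.1 + m.2 != 0)%N = o])
    (coef e m.1 * coef e m.2)%:E = (pair_factor c s e b1 b2 o)%:E.
Proof.
have tot := esum_product (coef_ge0 e) (coef_ge0 e) (esum_coef e b1) (esum_coef e b2).
have [bb|nbb] := boolP (b1 || b2).
  case: o; last first.
    rewrite [X in esum X _](_ : _ = set0); last first.
      apply/seteqP; split => // -[m1 m2] [/= o1 [o2 /negbFE/eqP m0]].
      have [z1 z2] : m1 = 0%N /\ m2 = 0%N by lia.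
      by move: bb; rewrite -o1 -o2 z1 z2.
    by rewrite esum_set0 /pair_factor bb.
  rewrite [X in esum X _](_ : _ = [set p | odd p.1 = b1 /\ odd p.2 = b2]).
    rewrite tot /pair_factor; congr (_%:E).
    by case: b1 b2 bb {tot} => [] [] //= _; rewrite ?expr2 // mulrC.
  apply/seteqP; split => -[m1 m2] /= [o1 o2]; first by case: o2.
  split => //; split => //; apply/eqP => m0.
  have [z1 z2] : m1 = 0%N /\ m2 = 0%N by lia.
  by move: bb; rewrite -o1 -o2 z1 z2.
move: nbb tot; rewrite negb_or => /andP[/negbTE -> /negbTE ->].
have F0 (m : nat * nat) : (0 <= (coef e m.1 * coef e m.2)%:E)%E.
  by rewrite lee_fin mulr_ge0 ?coef_ge0.
have one : \esum_(m in [set m : nat * nat |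
      odd m.1 = false /\ odd m.2 = false /\ (m.1 + m.2 != 0)%N = false])
    (coef e m.1 * coef e m.2)%:E = 1%:E.
  rewrite [X in esum X _](_ : _ = [set (0%N, 0%N)]).
    by rewrite esum_set1 // /coef /= expr0 fact0 divr1 mulr1.
  apply/seteqP; split => [[m1 m2] /= [_ [_ /negbFE/eqP m0]]|_ -> //].
  by congr pair; lia.
case: o => //.
rewrite (@esumID _ _ [set m | (m.1 + m.2 != 0)%N = false]); last by move=> m _; apply: F0.
rewrite [X in (esum X _ + _)%E](_ : _ = [set m : nat * nat |
      odd m.1 = false /\ odd m.2 = false /\ (m.1 + m.2 != 0)%N = false]); last first.
  by apply/seteqP; split => m /= => [[[? ?] ?]|[? [? ?]]].
rewrite one [X in (_ + esum X _)%E](_ : _ = [set m : nat * nat |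
      odd m.1 = false /\ odd m.2 = false /\ (m.1 + m.2 != 0)%N = true]); last first.
  apply/seteqP; split => m /= => [[[? ?] n0]|[? [? h]]]; last by split => //; rewrite h.
  by split => //; split => //; case: eqP n0.
rewrite /pair_factor /= -expr2 cosh_sinh.
case: (esum _ _) => [w| |] //= [h]; congr (_%:E).
by apply: (addrI 1); rewrite h addrC.
Qed.

Lemma esum_pair_class p q (O : {ffun edge E -> bool}) :
  \esum_(u in [set u : current E * current E |
      (current_parity u.1, current_parity u.2, support_add u.1 u.2) = (p, q, O)])
    (curr_weight J u.1 * curr_weight J u.2)%:E = (pair_weight c s p q O)%:E.
Proof.
pose A (e : edge E) := [set m : nat * nat |
  odd m.1 = p e /\ odd m.2 = q e /\ (m.1 + m.2 != 0)%N = O e].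
pose F (n : {ffun edge E -> nat * nat}) : current E * current E :=
  ([ffun e => (n e).1], [ffun e => (n e).2]).
rewrite (@reindex_esum _ _ _ [set n : {ffun edge E -> nat * nat} | forall e, A e (n e)] _
  F); last first.
  split.
  - move=> n nA /=; congr (_, _, _); apply/ffunP => e; rewrite !ffunE;
      by have [? [? ?]] := nA e.
  - move=> n n' _ _ [/ffunP e1 /ffunP e2]; apply/ffunP => e.
    by have := e1 e; have := e2 e; rewrite !ffunE;
      case: (n e) (n' e) => ? ? [? ?] /= -> ->.
  move=> [n1 n2] [/= pE qE OE]; exists [ffun e => (n1 e, n2 e)].
    by move=> e; rewrite /A /= ffunE /= -pE -qE -OE !ffunE.
  by congr pair; apply/ffunP => e; rewrite !ffunE.
rewrite -(@esum_prod_ffun _ _ _ (0%N, 0%N) A (fun e m => coef e m.1 * coef e m.2)).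
- apply: eq_esum => n _; congr (_%:E); rewrite -big_split /=.
  by apply: eq_bigr => e _; rewrite !ffunE.
- by move=> e m; rewrite mulr_ge0 ?coef_ge0.
by move=> e; apply: esum_pair_factor.
Qed.

(** Outside the prescribed sources the probability of a pair of currents is 0, so
that only the pairs with the right parities count, and for these the event depends
only on the support of the sum. *)
Lemma dcurr_probE (S : {set V}) (X : set (current E)) (G : pred {ffun edge E -> bool}) :
    (forall n1 n2, sources n1 = S -> sources n2 = finset.set0 ->
      X (curr_add n1 n2) <-> G (support_add n1 n2)) ->
  dcurr_prob J S X = ((\sum_(O | G O) pair_Z c s (mark S) 0 O) /
    (parity_Z c s (mark S) * parity_Z c s 0))%:E.
Proof.
move=> XG.
have mark0 : mark finset.set0 = 0 by apply/ffunP => x; rewrite !ffunE inE.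
have Z_ge0 T : 0 <= parity_Z c s (mark T).
  by rewrite -lee_fin -curr_ZE; apply: esum_ge0 => n _; rewrite lee_fin curr_weight_ge0.
set k := (parity_Z c s (mark S) * parity_Z c s 0)^-1.
have k0 : 0 <= k by rewrite invr_ge0 mulr_ge0 // -mark0.
pose C : finType := ({ffun edge E -> bool} * {ffun edge E -> bool} * {ffun edge E ->
  bool})%type.
pose kappa (u : current E * current E) : C :=
  (current_parity u.1, current_parity u.2, support_add u.1 u.2).
pose P (g : C) := [&& boundary g.1.1 == mark S, boundary g.1.2 == 0 & G g.2].
have w0 (u : current E * current E) : 0 <= curr_weight J u.1 * curr_weight J u.2.
  by rewrite mulr_ge0 ?curr_weight_ge0.
transitivity (\esum_(u in [set u | P (kappa u)])
    (k * (curr_weight J u.1 * curr_weight J u.2))%:E).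
  rewrite /dcurr_prob esum_mkcond [RHS]esum_mkcond; apply: eq_esum => -[n1 n2] _ /=.
  rewrite /curr_prob !sourcesE mark0 /= !curr_ZE mark0 /=.
  have PE : ((n1, n2) \in [set u | P (kappa u)]) = P (kappa (n1, n2)) by apply/idP/idP;
    rewrite inE.
  rewrite PE {1}/P /=; case: eqP => [s1|_] /=; last by rewrite mul0r; case: ifP.
  case: eqP => [s2|_] /=; last by rewrite mulr0; case: ifP.
  have {}XG : X (curr_add n1 n2) <-> G (support_add n1 n2).
    by apply: XG; apply/eqP; rewrite sourcesE ?s1 ?s2 ?mark0.
  have -> : ((n1, n2) \in [set p | X (curr_add p.1 p.2)]) = G (support_add n1 n2).
    by apply/idP/idP; rewrite inE /= => /XG.
  by case: ifP => // _; congr (_%:E); rewrite /k invfM; ring.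
rewrite (@esum_classes _ _ C kappa P _ (fun g => k * pair_weight c s g.1.1 g.1.2 g.2));
  first last.
- move=> [[p q] O]; apply: esum_scale => //.
  exact: esum_pair_class.
- by move=> u; rewrite mulr_ge0.
congr (_%:E); rewrite -mulr_sumr mulrC; congr (_ * _).
rewrite /pair_Z [RHS]exchange_big /=.
under [RHS]eq_bigr do rewrite exchange_big /=.
rewrite [RHS]pair_big_dep [RHS]pair_big_dep /=; apply: eq_bigl => -[[p q] O].
by rewrite /P /= andbA.
Qed.

End CurrentsParity.

(** * The probability of parallel connections *)

Lemma curr_connectedE (V : finType) (E : {set {set V}}) (n1 n2 : current E) x y :
  curr_connected (curr_add n1 n2) x y = link (support_add n1 n2) x y.
Proof.
apply: eq_connect => u w; apply: eq_existsb => e.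
by rewrite !ffunE.
Qed.

Lemma parity_uniq (V : finType) (S : {set V}) (t : seq V) :
  uniq t -> t =i S -> parity t = mark S.
Proof.
move=> ut tS; apply/ffunP => x; rewrite !ffunE count_uniq_mem // tS.
by case: (x \in S).
Qed.

Theorem theorem2p3 (R : realType) (V : finType) (E : {set {set V}})
    (J : edge E -> R) (rho : {perm dart E}) (outer : dart E)
    (k : nat) (a b : k.-tuple V) (v : (k.*2).-tuple V)
    (hE : simple_graph E) (hconn : connected_graph E)
    (hJ : forall e : edge E, 0 < J e)
    (hplane : plane_embedding rho)
    (hdisj : [disjoint [set x in a] & [set x in b]])
    (hab : ccw_order rho outer ([set x in a] :|: [set x in b])
             (tval a ++ rev (tval b)))
    (hv : ccw_order rho outer ([set x in a] :|: [set x in b]) (tval v)) :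
  dcurr_prob J ([set x in a] :|: [set x in b]) (parallel_connections a b) =
  (\det (corr_matrix J a b) / pfaffian (skew_corr_matrix J v))%:E.
Proof.
have J0 e : 0 <= J e by apply: ltW.
set S := ([set x in a] :|: [set x in b])%SET.
set c := cosh_coupling J; set s := sinh_coupling J.
have ncab (O : {ffun edge E -> bool}) : noncrossing (link O) (tval a ++ rev (tval b)) :=
  (@noncrossing_ccw _ _ _ hE hconn hplane O _ _ _ hab).
have ncv (O : {ffun edge E -> bool}) : noncrossing (link O) (tval v) :=
  (@noncrossing_ccw _ _ _ hE hconn hplane O _ _ _ hv).
have parab : parity (tval a ++ rev (tval b)) = mark S by case: hab => u e _;
  apply: parity_uniq.
have parv : parity (tval v) = mark S by case: hv => u e _; apply: parity_uniq.
have ab x : x \in b -> x \notin a.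
  move=> xb; apply/negP => xa; have /pred0P/(_ x) := hdisj.
  by rewrite /= !inE xa xb.
rewrite (dcurr_probE J0 (G := fun O => parallel_classes (link O) (tnth a) (tnth b)));
  last first.
  move=> n1 n2 s1 s2; rewrite /parallel_connections /Omega /=.
  have src : sources (curr_add n1 n2) = S.
    apply/eqP; rewrite sourcesE.
    have -> : current_parity (curr_add n1 n2) = current_parity n1 + current_parity n2.
      by apply/ffunP => e; rewrite ffun_boolD !ffunE oddD.
    move/eqP: s1; rewrite sourcesE => /eqP p1; move/eqP: s2; rewrite sourcesE => /eqP p2.
    rewrite boundaryD p1 p2; apply/eqP/ffunP => x.
    by rewrite ffun_boolD [mark finset.set0 x]ffunE finset.in_set0 addbF.
  split=> [[_ con ncon]|/andP[/forallP con /forallP ncon]].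
    apply/andP; split; apply/forallP => i; first by rewrite -curr_connectedE.
    by apply/forallP => j; apply/implyP => ij; rewrite -curr_connectedE; apply: ncon.
  split=> // [i|i j ij]; rewrite curr_connectedE //.
  by have /forallP/(_ j) := ncon i; rewrite ij.
have Z0 : source_Z c s [::] != 0 by apply: parity_Z0.
have cs1 := @cosh_sinh R V E J.
have -> : pfaffian (skew_corr_matrix J v) = pf (corr c s) v.
  by apply: pfaffian_pf => i j; rewrite mxE !ising_corrE.
have ZS : parity_Z c s (mark S) = source_Z c s [::] * pf (corr c s) v.
  by rewrite -parv; apply: (Z_pf hE cs1 Z0).
have := det_corr hE cs1 Z0 (origin outer) ab ncab.
have -> : \matrix_(i < k, j < k) corr c s (tnth a i) (tnth b j) = corr_matrix J a b.
  by apply/matrixP => i j; rewrite !mxE ising_corrE.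
rewrite /source_pair_Z parab => detE.
rewrite -/c -/s -parity_nil -/(source_Z c s [::]) ZS.
rewrite (_ : \sum_(O | _) _ = source_Z c s [::] ^+ 2 * \det (corr_matrix J a b));
  last first.
  rewrite detE big_mkcond; apply: eq_bigr => O _.
  by case: ifP; rewrite ?mulr1 ?mulr0.
congr (_%:E); move: (source_Z c s _) (pf _ _) (\det _) Z0 => z p d z0.
have -> : z * p * z = z ^+ 2 * p by ring.
by rewrite invfM mulrACA divff ?mul1r ?expf_neq0.
Qed.
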